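(* Let $S\subset\mathbb{R}$ be a measurable set and suppose that $|S_a|<a$ for some $a>0$, where $S_a:=(S+a\mathbb{Z})\cap[0,a]$ and $|\cdot|$ denotes Lebesgue measure. Then there is a uniformly discrete set $\Lambda\subset\mathbb{R}$ with uniform density $D(\Lambda)=a$ which is a uniqueness set for $W^{(\alpha)}_S$ for every $\alpha>1/2$.
   Context: Fourier transform: $\hat f(t)=\int_{\mathbb{R}} e^{-2\pi i t x}f(x)\,dx$. For $\alpha>1/2$, $W^{(\alpha)}$ is the space of functions $f$ whose Fourier transform $F=\hat f$ satisfies $\int_{\mathbb{R}}(1+|t|^{2\alpha})|F(t)|^2\,dt<\infty$ (such $F$ are integrable, so $f$ is continuous); $W^{(\alpha)}_S$ is the subspace of those $f$ with $F=0$ a.e. outside $S$. A set $\Lambda\subset\mathbb{R}$ is uniformly discrete if $\inf\{|\lambda-\lambda'|:\lambda,\lambda'\in\Lambda,\lambda\neq\lambda'\}>0$. It has uniform density $D(\Lambda)$ if $\mathrm{Card}(\Lambda\cap(x,x+r))=rD(\Lambda)+o(r)$ uniformly in $x$ as $r\to\infty$. A set $\Lambda$ is a uniqueness set for a space $F$ of continuous functions if $f\in F$, $f|_\Lambda=0$ imply $f=0$. *)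

(* Defs.v *)
From HB Require Import structures.
From mathcomp Require Import all_boot all_order all_algebra.
From mathcomp Require Import all_classical all_reals all_analysis.
From mathcomp Require Import complex.
Set Implicit Arguments. Unset Strict Implicit. Unset Printing Implicit Defensive.
Import Order.TTheory GRing.Theory Num.Theory.
Import numFieldNormedType.Exports.
Local Open Scope classical_set_scope.
Local Open Scope ring_scope.

(* Lebesgue measure on R, i.e. the *completed* Lebesgue measure, whose
   measurable sets are the Lebesgue measurable sets.  Its carrier is R. *)
Definition LebT (R : realType) :=
  caratheodory_type (R:=R)
    (T:=lebesgue_stieltjes_measure_ocitv_type__canonical__measurable_structure_SemiRingOfSets R)
    (wlength idfun)^*%mu.

Definition leb {R : realType} : set (LebT R) -> \bar R :=
  @completed_lebesgue_measure R.

Definition leb_measurable {R : realType} (S : set R) : Prop :=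
  @measurable _ (LebT R) S.

Definition S_per {R : realType} (S : set R) (a : R) : set R :=
  [set y | (0 <= y <= a) /\ exists s (k : int), S s /\ y = s + k%:~R * a].

Definition uniformly_discrete {R : realType} (L : set R) : Prop :=
  exists2 d : R, 0 < d &
    forall x y, L x -> L y -> x <> y -> d <= `|x - y|.

Definition card_in_window {R : realType} (L : set R) (x r : R) (n : nat) :
  Prop :=
  exists s : seq R, uniq s /\ size s = n /\
    (forall y, y \in s <-> (L y /\ x < y < x + r)).

Definition has_uniform_density {R : realType} (L : set R) (D : R) : Prop :=
  forall eps : R, 0 < eps -> exists r0 : R, forall r : R, r0 < r ->
    forall x : R, exists n : nat,
      card_in_window L x r n /\ `|n%:R - r * D| <= eps * r.

(* ∫_R e^{2π i t x} F(t) dt, computed through real and imaginary parts *)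
Definition inv_fourier {R : realType} (F : R -> R[i]) (x : R) : R[i] :=
  Complex
    (Rintegral (@leb R) setT (fun t : R =>
       cos (2 * pi * t * x) * complex.Re (F t) - sin (2 * pi * t * x) * complex.Im (F t)))
    (Rintegral (@leb R) setT (fun t : R =>
       sin (2 * pi * t * x) * complex.Re (F t) + cos (2 * pi * t * x) * complex.Im (F t))).

(* f ∈ W^{(α)}_S : f = inverse Fourier transform of F (equivalently
   \hat f = F), where F is (Lebesgue) measurable,
   ∫ (1 + |t|^{2α}) |F(t)|^2 dt < ∞, and F = 0 a.e. outside S. *)
Definition in_W {R : realType} (alpha : R) (S : set R) (f : R -> R[i]) :
  Prop :=
  exists F : R -> R[i],
    measurable_fun (T:=LebT R) setT (fun t => complex.Re (F t)) /\
    measurable_fun (T:=LebT R) setT (fun t => complex.Im (F t)) /\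
    (\int[@leb R]_(t in setT)
        ((1 + `|t| `^ (2 * alpha)) * (complex.Re (F t) ^+ 2 + complex.Im (F t) ^+ 2))%:E
      < +oo)%E /\
    {ae @leb R, forall t : LebT R, ~ S t -> F t = 0} /\
    (forall x, f x = inv_fourier F x).

Definition uniqueness_set {R : realType} (L : set R)
  (P : (R -> R[i]) -> Prop) : Prop :=
  forall f, P f -> (forall l, L l -> f l = 0) -> forall x, f x = 0.

(* Main.v *)
(** Write [w = 2 pi / a] and let [U] be an [a]-periodic set containing [S] whose
    trace on [(0, a)] has measure [< a]; it comes from a countable cover of
    [S_a] by intervals of total length [< a].  A trigonometric polynomial
    vanishing on a set of positive measure is zero, so the moments of degree at
    most [M] of a trigonometric polynomial restricted to the complement of [U]
    can be prescribed arbitrarily.  Approximating such a restriction by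
    trigonometric polynomials shows that every [cos (m w t)] and [sin (m w t)]
    is, in [L^2 (U mod a)], a limit of combinations of frequencies [> M] only,
    for every [M].  Hence the integers can be cut into successive blocks
    [M_k < |n| < M_(k+1)] so that block number [k] approximates a given
    frequency [m_k] with a given precision.

    On block [k] the lattice [Z / a] is translated by [x_k] in [0, 1 / a],
    where the triples ([m_k], [x_k], precision) run through a countable dense
    family; the points with [|n| = M_k] are moved by [1 / (2 a)], which keeps
    the perturbed lattice separated, and its density remains [a].  If [f]
    vanishes on it, then [F (t) e^(2 pi i t x_k)] is orthogonal to the
    frequencies of block [k].  Since the weight [1 + |t|^(2 alpha)] makes
    [1 / weight] summable over the translates by [a Z], a small norm in
    [L^2 (U mod a)] gives a small pairing with [F], so [f] vanishes at all the
    points [q / a] with [q] rational, and [f] is continuous. *)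

Require Import Defs.
From HB Require Import structures.
From mathcomp Require Import all_boot all_order all_algebra.
From mathcomp Require Import all_classical all_reals all_analysis.
From mathcomp Require Import complex measurable_realfun zify ring lra.
Import Order.TTheory GRing.Theory Num.Theory.
Import numFieldNormedType.Exports.
Local Open Scope classical_set_scope.
Local Open Scope ring_scope.

(** * Trigonometric polynomials *)

Section TrigPoly.
Context {R : realType}.
Variable w : R.

(* Enumerates 1, sin, cos, sin 2, cos 2, ...: the frequency of [tb i] is
   [uphalf i]. *)
Definition tb (i : nat) (t : R) : R :=
  if odd i then sin ((uphalf i)%:R * (w * t)) else cos ((uphalf i)%:R * (w *
      t)).

Definition tpoly (P : R -> R) : Prop :=
  exists N (c : nat -> R), forall t, P t = \sum_(i < N) c i * tb i t.

Lemma tb_norm_le1 i t : `|tb i t| <= 1.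
Proof. by rewrite /tb; case: ifP => _; [exact: sin_max|exact: cos_max]. Qed.

Lemma tpoly_ext P Q : tpoly P -> (forall t, Q t = P t) -> tpoly Q.
Proof. by move=> [N [c Pc]] QP; exists N, c => t; rewrite QP Pc. Qed.

Lemma tpoly_coeff P N : tpoly P ->
  exists M (c : nat -> R), (N <= M)%N /\
    forall t, P t = \sum_(i < M) c i * tb i t.
Proof.
move=> [K [c Pc]]; exists (maxn N K), (fun i => if (i < K)%N then c i else 0).
split; first exact: leq_maxl.
move=> t; rewrite Pc.
rewrite (big_ord_widen (maxn N K) (fun i => c i * tb i t)) ?leq_maxr//.
by rewrite big_mkcond/=; apply: eq_bigr => i _; case: ifP => // _; rewrite
    mul0r.
Qed.

Lemma tpoly_tb i : tpoly (tb i).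
Proof.
exists i.+1, (fun j => (j == i)%:R) => t.
rewrite big_ord_recr/= eqxx mul1r big1 ?add0r// => j _.
by rewrite (ltn_eqF (ltn_ord j)) mul0r.
Qed.

Lemma tpoly0 : tpoly (fun=> 0).
Proof. by exists 0%N, (fun=> 0) => t; rewrite big_ord0. Qed.

Lemma tpolyZ k P : tpoly P -> tpoly (fun t => k * P t).
Proof.
move=> [N [c Pc]]; exists N, (fun i => k * c i) => t.
by rewrite Pc mulr_sumr; apply: eq_bigr => i _; rewrite mulrA.
Qed.

Lemma tpolyD P Q : tpoly P -> tpoly Q -> tpoly (fun t => P t + Q t).
Proof.
move=> tP /(tpoly_coeff _ 0)[N [d [_ Qd]]].
have [M [c [NM Pc]]] := tpoly_coeff _ N tP.
exists M, (fun i => c i + (if (i < N)%N then d i else 0)) => t.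
rewrite Pc Qd (big_ord_widen M (fun i => d i * tb i t))// [X in _ +
    X]big_mkcond/=.
rewrite -big_split/=; apply: eq_bigr => i _; rewrite mulrDl.
by case: ifP => // _; rewrite mul0r.
Qed.

Lemma tpoly_sum (I : Type) (r : seq I) (P : I -> R -> R) :
  (forall i, tpoly (P i)) -> tpoly (fun t => \sum_(i <- r) P i t).
Proof.
move=> tP; elim: r => [|i r ih].
  by apply: (tpoly_ext _ _ tpoly0) => t; rewrite big_nil.
by apply: (tpoly_ext _ _ (tpolyD _ _ (tP i) ih)) => t; rewrite big_cons.
Qed.

Lemma tpoly_cos n : tpoly (fun t => cos (n%:R * (w * t))).
Proof.
apply: (tpoly_ext _ _ (tpoly_tb n.*2)) => t.
by rewrite /tb odd_double uphalf_double.
Qed.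

Lemma tpoly_sin n : tpoly (fun t => sin (n%:R * (w * t))).
Proof.
case: n => [|n]; first by apply: (tpoly_ext _ _ tpoly0) => t; rewrite mul0r
    sin0.
apply: (tpoly_ext _ _ (tpoly_tb n.*2.+1)) => t.
by rewrite /tb /= odd_double /= doubleK.
Qed.

Lemma tpoly_cst k : tpoly (fun=> k).
Proof.
apply: (tpoly_ext _ _ (tpolyZ k _ (tpoly_cos 0))) => t.
by rewrite mul0r cos0 mulr1.
Qed.

Lemma tpoly_cosB m n : tpoly (fun t => cos (m%:R * (w * t) - n%:R * (w * t))).
Proof.
wlog nm : m n / (n <= m)%N.
  move=> H; have [|/ltnW mn] := leqP n m; first exact: H.
  by apply: (tpoly_ext _ _ (H n m mn)) => t; rewrite -cosN opprB.
apply: (tpoly_ext _ _ (tpoly_cos (m - n))) => t.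
by rewrite natrB// mulrBl.
Qed.

Lemma tpoly_sinB m n : tpoly (fun t => sin (m%:R * (w * t) - n%:R * (w * t))).
Proof.
wlog nm : m n / (n <= m)%N.
  move=> H; have [|/ltnW mn] := leqP n m; first exact: H.
  apply: (tpoly_ext _ _ (tpolyZ (- 1) _ (H n m mn))) => t.
  by rewrite mulN1r -sinN opprB.
apply: (tpoly_ext _ _ (tpoly_sin (m - n))) => t.
by rewrite natrB// mulrBl.
Qed.

Lemma tpoly_cosDn m n : tpoly (fun t => cos (m%:R * (w * t) + n%:R * (w * t))).
Proof.
by apply: (tpoly_ext _ _ (tpoly_cos (m + n))) => t; rewrite natrD mulrDl.
Qed.

Lemma tpoly_sinDn m n : tpoly (fun t => sin (m%:R * (w * t) + n%:R * (w * t))).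
Proof.
by apply: (tpoly_ext _ _ (tpoly_sin (m + n))) => t; rewrite natrD mulrDl.
Qed.

(** Product-to-sum formulas, one for each pair of parities; by bilinearity they make the
    trigonometric polynomials an algebra. *)
Lemma tpoly_tbM i j : tpoly (fun t => tb i t * tb j t).
Proof.
rewrite /tb; set m := uphalf i; set n := uphalf j.
case: (odd i); case: (odd j).
- apply: (tpoly_ext _ _ (tpolyZ (1/2) _ (tpolyD _ _ (tpoly_cosB m n)
    (tpolyZ (-1) _ (tpoly_cosDn m n))))) => t.
  by rewrite cosB cosD; lra.
- apply: (tpoly_ext _ _ (tpolyZ (1/2) _ (tpolyD _ _ (tpoly_sinDn m n)
    (tpoly_sinB m n)))) => t.
  by rewrite sinD sinB; lra.
- apply: (tpoly_ext _ _ (tpolyZ (1/2) _ (tpolyD _ _ (tpoly_sinDn m n)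
    (tpolyZ (-1) _ (tpoly_sinB m n))))) => t.
  by rewrite sinD sinB; lra.
- apply: (tpoly_ext _ _ (tpolyZ (1/2) _ (tpolyD _ _ (tpoly_cosB m n)
    (tpoly_cosDn m n)))) => t.
  by rewrite cosB cosD; lra.
Qed.

Lemma tpolyM P Q : tpoly P -> tpoly Q -> tpoly (fun t => P t * Q t).
Proof.
move=> [N [c Pc]] [M [d Qd]].
apply: (@tpoly_ext (fun t =>
    \sum_(i < N) \sum_(j < M) c i * d j * (tb i t * tb j t))).
  apply: tpoly_sum => i; apply: tpoly_sum => j.
  exact/tpolyZ/tpoly_tbM.
move=> t; rewrite Pc Qd mulr_suml; apply: eq_bigr => i _.
by rewrite mulr_sumr; apply: eq_bigr => j _; ring.
Qed.

Lemma tpolyX n P : tpoly P -> tpoly (fun t => P t ^+ n).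
Proof.
move=> tP; elim: n => [|n ih].
  by apply: (tpoly_ext _ _ (tpoly_cst 1)) => t; rewrite expr0.
by apply: (tpoly_ext _ _ (tpolyM _ _ tP ih)) => t; rewrite exprS.
Qed.

Lemma tpoly_bounded P : tpoly P ->
  exists2 C, 0 <= C & forall t, `|P t| <= C.
Proof.
move=> [N [c Pc]]; exists (\sum_(i < N) `|c i|); first exact: sumr_ge0.
move=> t; rewrite Pc; apply: le_trans (ler_norm_sum _ _ _) _.
by apply: ler_sum => i _; rewrite normrM ler_piMr// tb_norm_le1.
Qed.

Lemma continuous_tb i : continuous (tb i).
Proof.
move=> t; rewrite /tb; have H : {for t, continuous (fun t => (uphalf i)%:R *
    (w * t))}.
  by apply: cvgM; [exact: cvg_cst|apply: cvgM; [exact: cvg_cst|exact: cvg_id]].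
case: (odd i).
  by apply: (continuous_comp H); exact: continuous_sin.
by apply: (continuous_comp H); exact: continuous_cos.
Qed.

Lemma continuous_tpoly P : tpoly P -> continuous P.
Proof.
move=> [N [c Pc]]; have -> : P = fun t => \sum_(i < N) c i * tb i t.
  by apply/funext.
move=> {P Pc}; elim: N => [|N ih] t.
  under eq_fun do rewrite big_ord0.
  exact: cvg_cst.
under eq_fun do rewrite big_ord_recr/=.
by apply: cvgD; [exact: ih|apply: cvgM; [exact: cvg_cst|exact: continuous_tb]].
Qed.

Let z (t : R) : R[i] := Complex (cos (w * t)) (sin (w * t)).

Lemma circleX n t : z t ^+ n = Complex (cos (n%:R * (w * t))) (sin (n%:R * (w
    * t))).
Proof.
elim: n => [|n ih]; first by rewrite mul0r cos0 sin0 expr0.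
rewrite exprS ih -natr1 mulrDl mul1r cosD sinD.
by apply/eqP; rewrite eq_complex /=; apply/andP; split; apply/eqP; ring.
Qed.

(* On the circle [z = e^(iwt)], multiplication by [z ^+ N] clears the negative
   powers, so that the zeros of a trigonometric polynomial are finite in
       number. *)
Lemma tb_circle_poly i N : (uphalf i <= N)%N ->
  exists q : {poly R[i]}, forall t, q.[z t] = z t ^+ N * (tb i t)%:C%C.
Proof.
rewrite /tb; set n := uphalf i => nN.
have e (t : R) : cos (n%:R * (w * t)) ^+ 2 + sin (n%:R * (w * t)) ^+ 2 = 1.
  exact: cos2Dsin2.
case: (odd i).
- exists ((- 'i%C / 2) *: ('X^(N - n) * ('X^n ^+ 2 - 1))) => t.
  rewrite hornerZ hornerM mulrCA hornerXn -[in RHS](subnK nN) exprD -[RHS]mulrA.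
  congr (_ * _); rewrite !hornerE /= circleX ?mulrA -?mulrA.
  have := e t; set C := cos _; set S := sin _ => e1.
  have e2 : S ^+ 2 = 1 - C ^+ 2 by rewrite -e1; ring.
  have -> : (Complex C S) ^+ 2 - 1 = 2 * ('i * (Complex C S * S%:C))%C.
    rewrite mulr_natl mulr2n; apply/eqP; rewrite eq_complex expr2 /=.
    by apply/andP; split; apply/eqP; ring: e2.
  rewrite (mulKf (x := 2)) ?pnatr_eq0// mulrA mulNr -expr2 sqr_i.
  by rewrite opprK mul1r.
- exists ((1 / 2) *: ('X^(N - n) * ('X^n ^+ 2 + 1))) => t.
  rewrite hornerZ hornerM mulrCA hornerXn -[in RHS](subnK nN) exprD -[RHS]mulrA.
  congr (_ * _); rewrite !hornerE /= circleX ?mulrA -?mulrA.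
  have := e t; set C := cos _; set S := sin _ => e1.
  have e2 : S ^+ 2 = 1 - C ^+ 2 by rewrite -e1; ring.
  have -> : (Complex C S) ^+ 2 + 1 = 2 * (Complex C S * C%:C)%C.
    rewrite mulr_natl mulr2n; apply/eqP; rewrite eq_complex expr2 /=.
    by apply/andP; split; apply/eqP; ring: e2.
  by rewrite mulKf ?pnatr_eq0.
Qed.

Lemma circle_poly_of_tpoly P : tpoly P ->
  exists N (q : {poly R[i]}), forall t, q.[z t] = z t ^+ N * (P t)%:C%C.
Proof.
move=> [N [c Pc]]; exists N.
have H (i : 'I_N) : exists q : {poly R[i]}, forall t, q.[z t] = z t ^+ N * (tb
    i t)%:C%C.
  by apply: tb_circle_poly; have := ltn_ord i; rewrite uphalf_half
      -{1}(odd_double_half i); lia.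
have [q qE] := choice H.
exists (\sum_(i < N) (c i)%:C%C *: q i) => t.
rewrite Pc rmorph_sum mulr_sumr horner_sum; apply: eq_bigr => i _.
by rewrite hornerZ qE rmorphM /= mulrCA.
Qed.

Lemma circle_neq0 t : z t != 0.
Proof.
apply/eqP => -[c0 s0]; have := cos2Dsin2 (w * t).
by rewrite c0 s0 expr0n/= addr0 => /esym/eqP; rewrite oner_eq0.
Qed.

(** The polynomial [q] attached to [P] vanishes at the distinct points [z t] for [t] in the infinite
    set [A]. Hence [q = 0], and [P = 0] because [z] never vanishes. *)
Lemma tpoly_eq0 P (A : set R) : tpoly P -> infinite_set A ->
  {in A &, injective z} -> (forall t, A t -> P t = 0) -> forall t, P t = 0.
Proof.
move=> /circle_poly_of_tpoly[N [q qE]] iA zinj A0.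
suff q0 : q = 0.
  move=> t; have := qE t; rewrite q0 horner0 => /esym/eqP.
  rewrite mulf_eq0 expf_eq0 (negbTE (circle_neq0 t)) andbF/= => /eqP[].
  by [].
apply/eqP/negP => /negP q0.
have [B BA sB] := infinite_set_fset (size q) iA.
have := max_poly_roots q0 (rs := map z (finmap.enum_fset B)).
rewrite size_map ltnNge sB => H; apply/notF/H.
  apply/allP => _ /mapP[t tB ->]; rewrite /root qE A0 ?mulr0//.
  exact: BA.
rewrite map_inj_in_uniq ?finmap.fset_uniq// => x y xB yB.
by apply: zinj; apply/mem_set/BA.
Qed.
End TrigPoly.

Lemma sin_eq0_ltpi {R : realType} (x : R) : - pi < x < pi -> sin x = 0 -> x = 0.
Proof.
move=> /andP[x1 x2] sx; have [x0|x0|//] := ltgtP x 0.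
  have : 0 < sin (- x) by apply: sin_gt0_pi; lra.
  by rewrite sinN sx oppr0 ltxx.
by have := @sin_gt0_pi _ x; rewrite x0 x2 sx ltxx => /(_ isT).
Qed.

(** Equal values give [cos (u - v) = 1] for the two phases, that is [sin (d * pi) = 0] with
    [d = (x - y) / a] strictly between -1 and 1. *)
Lemma circle_inj {R : realType} (a : R) : 0 < a ->
  {in `]0, a[%classic &, injective (fun t : R => Complex (cos (2 * pi / a *
      t)) (sin (2 * pi / a * t)))}.
Proof.
move=> a0 x y /set_mem/=; rewrite in_itv/= => /andP[x0 xa].
move=> /set_mem/=; rewrite in_itv/= => /andP[y0 ya] [ec es].
set u := 2 * pi / a * x in ec es *; set v := 2 * pi / a * y in ec es *.
pose d := (x - y) / a.
have duv : u - v = (d * pi) *+ 2 by rewrite /u /v /d mulr2n; ring.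
have : cos (u - v) = 1 by rewrite cosB ec es -!expr2 cos2Dsin2.
rewrite duv cos_mulr2n cos2sin2 => h.
have s0 : sin (d * pi) = 0.
  by apply/eqP; rewrite -sqrf_eq0; apply/eqP; lra.
have d1 : -1 < d < 1.
  by rewrite /d ltr_pdivlMr// ltr_pdivrMr//; apply/andP; split; lra.
have p0 := pi_gt0 R.
have : d * pi = 0.
  apply: sin_eq0_ltpi => //; move/andP: d1 => [d1 d2].
  by apply/andP; split; nra.
move/eqP; rewrite mulf_eq0 (gt_eqF p0) orbF /d mulf_eq0 invr_eq0 (gt_eqF a0)
    orbF.
by rewrite subr_eq0 => /eqP.
Qed.

(** * Orthogonality on one period *)

Section BoundedMeasurable.
Context {R : realType}.
Notation mu := (@lebesgue_measure R).

(** A class stable under the algebraic operations that contains the trigonometric polynomials and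
    the indicators of Borel sets; its members are integrable over every Borel set of finite
    measure. *)
Definition bmeas (f : R -> R) : Prop :=
  measurable_fun setT f /\ exists C, forall t, `|f t| <= C.

Lemma bmeasD f g : bmeas f -> bmeas g -> bmeas (fun t => f t + g t).
Proof.
move=> [mf [C fC]] [mg [D gD]]; split; first exact: measurable_funD.
by exists (C + D) => t; rewrite (le_trans (ler_normD _ _))// lerD.
Qed.

Lemma bmeasM f g : bmeas f -> bmeas g -> bmeas (fun t => f t * g t).
Proof.
move=> [mf [C fC]] [mg [D gD]]; split; first exact: measurable_funM.
by exists (C * D) => t; rewrite normrM ler_pM.
Qed.

Lemma bmeas_cst k : bmeas (fun=> k).
Proof. by split; [exact: measurable_cst|exists `|k|]. Qed.

Lemma bmeasZ k f : bmeas f -> bmeas (fun t => k * f t).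
Proof. by move=> bf; apply: bmeasM => //; exact: bmeas_cst. Qed.

Lemma bmeasB f g : bmeas f -> bmeas g -> bmeas (fun t => f t - g t).
Proof.
move=> bf bg; have := bmeasD _ _ bf (bmeasZ (-1) _ bg).
by under eq_fun do rewrite mulN1r.
Qed.

Lemma bmeas_norm f : bmeas f -> bmeas (fun t => `|f t|).
Proof.
move=> [mf [C fC]]; split; first exact: measurableT_comp.
by exists C => t; rewrite normr_id.
Qed.

Lemma bmeas_sum (I : Type) (r : seq I) (f : I -> R -> R) :
  (forall i, bmeas (f i)) -> bmeas (fun t => \sum_(i <- r) f i t).
Proof.
move=> bf; elim: r => [|i r ih].
  by under eq_fun do rewrite big_nil; exact: bmeas_cst.
by under eq_fun do rewrite big_cons; exact: bmeasD.
Qed.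

Lemma bmeas_tpoly w P : tpoly w P -> bmeas P.
Proof.
move=> tP; split.
  by apply: continuous_measurable_fun; exact: continuous_tpoly tP.
by have [C _ PC] := tpoly_bounded _ _ tP; exists C.
Qed.

Lemma bmeas_tb w i : bmeas (tb w i).
Proof. exact/bmeas_tpoly/tpoly_tb. Qed.

Lemma bmeas_indic (A : set R) : measurable A -> bmeas \1_A.
Proof.
move=> mA; split; first exact: measurable_indic.
exists 1 => t; rewrite indicE ger0_norm ?ler0n//.
by case: (_ \in _).
Qed.

Lemma bmeas_integrable (E : set R) f : measurable E -> (mu E < +oo)%E ->
  bmeas f -> mu.-integrable E (EFin \o f).
Proof.
move=> mE Ey [mf [C fC]]; apply: measurable_bounded_integrable => //.
  exact: measurable_funS mf.
exists C; split; first exact: num_real.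
by move=> x Cx t Et /=; apply: le_trans (fC t) _; exact: ltW.
Qed.

Lemma Rintegral_sum_bmeas (E : set R) (I : Type) (r : seq I) (f : I -> R -> R) :
  measurable E -> (mu E < +oo)%E -> (forall i, bmeas (f i)) ->
  \int[mu]_(t in E) (\sum_(i <- r) f i t) = \sum_(i <- r) \int[mu]_(t in E) f
      i t.
Proof.
move=> mE Ey bf; elim: r => [|i r ih].
  under eq_Rintegral do rewrite big_nil.
  by rewrite Rintegral_cst// mul0r big_nil.
under eq_Rintegral do rewrite big_cons.
rewrite RintegralD//; last 2 first.
  exact: bmeas_integrable.
  by apply: bmeas_integrable => //; exact: bmeas_sum.
by rewrite ih big_cons.
Qed.

End BoundedMeasurable.

(** * Integrals of the trigonometric system over one period *)

Section Orthogonality.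
Context {R : realType}.
Variable a : R.
Hypothesis a0 : 0 < a.
Notation mu := (@lebesgue_measure R).
Let w : R := 2 * pi / a.
Let D : set R := `]0, a[%classic.

Lemma measure_oa : mu D = a%:E.
Proof. by rewrite /D lebesgue_measure_itv/= lte_fin a0 -EFinD subr0. Qed.

Lemma measure_oa_fin : (mu D < +oo)%E.
Proof. by rewrite measure_oa ltry. Qed.

Lemma measurable_oa : measurable D.
Proof. exact: measurable_itv. Qed.

Lemma sin_nat_2pi n : sin (n%:R * (2 * pi)) = 0 :> R.
Proof.
have -> : n%:R * (2 * pi) = 0 + (pi *+ 2) *+ n :> R.
  by rewrite add0r -[RHS]mulr_natl -[pi *+ 2]mulr_natl.
by rewrite (periodicn (@sinD2pi R)) sin0.
Qed.

Lemma cos_nat_2pi n : cos (n%:R * (2 * pi)) = 1 :> R.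
Proof.
have -> : n%:R * (2 * pi) = 0 + (pi *+ 2) *+ n :> R.
  by rewrite add0r -[RHS]mulr_natl -[pi *+ 2]mulr_natl.
by rewrite (periodicn (@cosD2pi R)) cos0.
Qed.

Lemma FTC_oa (f F : R -> R) : continuous f -> bmeas f ->
  (forall x : R, is_derive x 1 F (f x)) ->
  \int[mu]_(t in D) f t = F a - F 0.
Proof.
move=> cf bf dF.
(* Both endpoints are added, which does not change the integral, to reach the closed interval of the
   fundamental theorem of calculus. *)
rewrite /D Rintegral_itv_bndo_bndc; last exact: (bmeas_integrable _ _
    measurable_oa measure_oa_fin).
rewrite Rintegral_itv_obnd_cbnd; last first.
  apply: bmeas_integrable => //.
  by rewrite /D lebesgue_measure_itv/= lte_fin a0 -EFinD ltry.
have cF : continuous F.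
  by move=> x; apply/differentiable_continuous/derivable1_diffP; case: (dF x).
rewrite /Rintegral (@continuous_FTC2 _ _ F)//.
- exact: continuous_subspaceT.
- split.
  + by move=> x _; case: (dF x).
  + by apply: cvg_at_right_filter; exact: cF.
  + by apply: cvg_at_left_filter; exact: cF.
- by move=> x _; rewrite derive1E; case: (dF x).
Qed.

Lemma int_cos n : \int[mu]_(t in D) cos (n%:R * (w * t)) = if n == 0%N then a
    else 0.
Proof.
case: n => [|n].
  under eq_Rintegral do rewrite mul0r cos0.
  rewrite Rintegral_cst; [by rewrite /= measure_oa mul1r|exact: measurable_oa].
pose k := n.+1%:R * w.
have k0 : k != 0.
  by rewrite /k /w !mulf_neq0 ?pnatr_eq0 ?invr_neq0 ?(gt_eqF a0)// gt_eqF//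
      pi_gt0.
have dF (x : R) : is_derive x 1 (fun t => k^-1 * sin (k * t)) (cos (n.+1%:R *
    (w * x))).
  rewrite mulrA -/k; apply: is_derive_eq.
  by rewrite /GRing.scale/= !(mulr0, mulr1, add0r, addr0); field.
rewrite (@FTC_oa _ (fun t => k^-1 * sin (k * t)) _ _ dF).
- rewrite mulr0 sin0 mulr0 subr0.
  have -> : k * a = n.+1%:R * (2 * pi) by rewrite /k /w -!mulrA mulVf ?mulr1
      ?gt_eqF.
  by rewrite sin_nat_2pi mulr0.
- exact/continuous_tpoly/tpoly_cos.
- exact/bmeas_tpoly/tpoly_cos.
Qed.

Lemma int_sin n : \int[mu]_(t in D) sin (n%:R * (w * t)) = 0.
Proof.
case: n => [|n].
  under eq_Rintegral do rewrite mul0r sin0.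
  by rewrite Rintegral_cst; [rewrite mul0r|exact: measurable_oa].
pose k := n.+1%:R * w.
have k0 : k != 0.
  by rewrite /k /w !mulf_neq0 ?pnatr_eq0 ?invr_neq0 ?(gt_eqF a0)// gt_eqF//
      pi_gt0.
have dF (x : R) : is_derive x 1 (fun t => - k^-1 * cos (k * t)) (sin (n.+1%:R
    * (w * x))).
  rewrite mulrA -/k; apply: is_derive_eq.
  by rewrite /GRing.scale/= !(mulr0, mulr1, add0r, addr0); field.
rewrite (@FTC_oa _ (fun t => - k^-1 * cos (k * t)) _ _ dF).
- rewrite mulr0 cos0.
  have -> : k * a = n.+1%:R * (2 * pi) by rewrite /k /w -!mulrA mulVf ?mulr1
      ?gt_eqF.
  by rewrite cos_nat_2pi subrr.
- exact/continuous_tpoly/tpoly_sin.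
- exact/bmeas_tpoly/tpoly_sin.
Qed.

Lemma int_cosB m n : \int[mu]_(t in D) cos (m%:R * (w * t) - n%:R * (w * t)) =
  if m == n then a else 0.
Proof.
wlog nm : m n / (n <= m)%N.
  move=> H; have [|/ltnW mn] := leqP n m; first exact: H.
  rewrite eq_sym -H//; apply: eq_Rintegral => t _.
  by rewrite -cosN opprB.
under eq_Rintegral do rewrite -mulrBl -natrB//.
by rewrite int_cos subn_eq0 eqn_leq nm andbT.
Qed.

Lemma int_sinB m n : \int[mu]_(t in D) sin (m%:R * (w * t) - n%:R * (w * t)) =
    0.
Proof.
have [nm|/ltnW mn] := leqP n m.
  under eq_Rintegral do rewrite -mulrBl -natrB//.
  exact: int_sin.
under eq_Rintegral do rewrite -opprB sinN -mulN1r -mulrBl -natrB//.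
rewrite RintegralZl ?int_sin ?mulr0//; first exact: measurable_oa.
by apply: bmeas_integrable; [exact: measurable_oa|exact:
    measure_oa_fin|exact/bmeas_tpoly/tpoly_sin].
Qed.

(** The squared norm of [tb w i] in [L^2 (0, a)]. *)
Definition tbn2 (i : nat) : R := if i == 0%N then a else a / 2.

Lemma tbn2_gt0 i : 0 < tbn2 i.
Proof. by rewrite /tbn2; case: ifP => // _; rewrite divr_gt0. Qed.

Lemma int_half_lin (f g : R -> R) s : bmeas f -> bmeas g ->
  \int[mu]_(t in D) (1 / 2 * (f t + s * g t)) =
  (\int[mu]_(t in D) f t + s * \int[mu]_(t in D) g t) / 2.
Proof.
move=> bf bg.
have I h : bmeas h -> mu.-integrable D (EFin \o h).
  by move=> bh; apply: bmeas_integrable; [exact: measurable_oa|exact: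
      measure_oa_fin|].
have mD := measurable_oa.
rewrite RintegralZl//; last by apply: I; apply: bmeasD => //; exact: bmeasZ.
rewrite RintegralD//; [|exact: I|by apply: I; exact: bmeasZ].
by rewrite RintegralZl//; [lra|exact: I].
Qed.

(** After the product-to-sum formulas only cosines of frequency zero contribute. Indices of equal
    parity coincide exactly when their frequencies do, and a sum of two frequencies is zero only for
    [i = j = 0]. *)
Lemma int_tbM i j : \int[mu]_(t in D) (tb w i t * tb w j t) =
  if i == j then tbn2 i else 0.
Proof.
have ei := odd_double_half i; have ej := odd_double_half j.
rewrite /tb /tbn2; set m := uphalf i; set n := uphalf j.
have em : m = (odd i + i./2)%N by rewrite /m uphalf_half.
have en : n = (odd j + j./2)%N by rewrite /n uphalf_half.
case oi: (odd i) in ei em *; case oj: (odd j) in ej en *.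
- transitivity (\int[mu]_(t in D) (1 / 2 * (cos (m%:R * (w * t) - n%:R * (w *
      t)) + (- 1) * cos ((m + n)%:R * (w * t))))).
    by apply: eq_Rintegral => t _; rewrite natrD mulrDl cosB cosD; lra.
  rewrite (int_half_lin _ _ _ (bmeas_tpoly _ _ (tpoly_cosB _ _ _))
      (bmeas_tpoly _ _ (tpoly_cos _ _))).
  rewrite int_cosB int_cos.
  have -> : (m + n == 0)%N = false by apply/eqP; lia.
  rewrite mulr0 addr0; have -> : (m == n) = (i == j) by apply/eqP/eqP; lia.
  by case: ifP => _; rewrite ?mul0r//; case: ifP => // /eqP; lia.
- transitivity (\int[mu]_(t in D) (1 / 2 * (sin ((m + n)%:R * (w * t)) + 1 *
      sin (m%:R * (w * t) - n%:R * (w * t))))).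
    by apply: eq_Rintegral => t _; rewrite natrD mulrDl sinB sinD; lra.
  rewrite (int_half_lin _ _ _ (bmeas_tpoly _ _ (tpoly_sin _ _)) (bmeas_tpoly _
      _ (tpoly_sinB _ _ _))).
  rewrite int_sinB int_sin mulr0 addr0 mul0r.
  by case: ifP => // /eqP; lia.
- transitivity (\int[mu]_(t in D) (1 / 2 * (sin ((m + n)%:R * (w * t)) + (- 1)
      * sin (m%:R * (w * t) - n%:R * (w * t))))).
    by apply: eq_Rintegral => t _; rewrite natrD mulrDl sinB sinD; lra.
  rewrite (int_half_lin _ _ _ (bmeas_tpoly _ _ (tpoly_sin _ _)) (bmeas_tpoly _
      _ (tpoly_sinB _ _ _))).
  rewrite int_sinB int_sin mulr0 addr0 mul0r.
  by case: ifP => // /eqP; lia.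
- transitivity (\int[mu]_(t in D) (1 / 2 * (cos (m%:R * (w * t) - n%:R * (w *
      t)) + 1 * cos ((m + n)%:R * (w * t))))).
    by apply: eq_Rintegral => t _; rewrite natrD mulrDl cosB cosD; lra.
  rewrite (int_half_lin _ _ _ (bmeas_tpoly _ _ (tpoly_cosB _ _ _))
      (bmeas_tpoly _ _ (tpoly_cos _ _))).
  rewrite int_cosB int_cos.
  have -> : (m == n) = (i == j) by apply/eqP/eqP; lia.
  case: ifP => [/eqP ij|ij]; last first.
    have -> : (m + n == 0)%N = false by apply/eqP; lia.
    by rewrite mulr0 addr0 mul0r.
  have -> : (m + n == 0)%N = (i == 0)%N by apply/eqP/eqP; lia.
  by case: ifP => _; lra.
Qed.

Lemma int_tb_coef N (c : nat -> R) i : (i < N)%N ->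
  \int[mu]_(t in D) ((\sum_(j < N) c j * tb w j t) * tb w i t) = c i * tbn2 i.
Proof.
move=> iN; under eq_Rintegral do rewrite mulr_suml.
have mD := measurable_oa; have Dy := measure_oa_fin.
rewrite (Rintegral_sum_bmeas _ _ _ (fun (j : 'I_N) t => c j * tb w j t * tb w
    i t))//; last first.
  by move=> j; apply: bmeasM; [apply: bmeasZ|]; exact: bmeas_tb.
rewrite (bigD1 (Ordinal iN))//= big1 ?addr0 => [|j ji].
  under eq_Rintegral do rewrite -mulrA.
  rewrite RintegralZl//; first by rewrite int_tbM eqxx.
  by apply: bmeas_integrable => //; apply: bmeasM; exact: bmeas_tb.
under eq_Rintegral do rewrite -mulrA.
rewrite RintegralZl//; last by apply: bmeas_integrable => //; apply: bmeasM;
    exact: bmeas_tb.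
rewrite int_tbM; case: ifP => [/eqP e|_]; last by rewrite mulr0.
by move/eqP: ji; case; apply/val_inj.
Qed.
End Orthogonality.

(** * Approximation of indicators by trigonometric polynomials *)

Section Step.
Context {R : realType}.

Lemma bernoulli_ge (x : R) m : 0 <= x -> 1 + m%:R * x <= (1 + x) ^+ m.
Proof.
move=> x0; elim: m => [|m ih]; first by rewrite mul0r addr0 expr0.
rewrite exprS (le_trans _ (ler_wpM2l _ ih)) ?addr_ge0//.
have : 0 <= m%:R * x * x by rewrite !mulr_ge0.
by rewrite -natr1; nra.
Qed.

Lemma bernoulli_le (x : R) m : 0 <= x <= 1 -> 1 - m%:R * x <= (1 - x) ^+ m.
Proof.
move=> /andP[x0 x1]; elim: m => [|m ih]; first by rewrite mul0r subr0 expr0.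
rewrite exprS (le_trans _ (ler_wpM2l _ ih)) ?subr_ge0//.
have : 0 <= m%:R * x * x by rewrite !mulr_ge0.
by rewrite -natr1; nra.
Qed.

(* Polynomials tending on [0, 1] to the indicator of [y < 1/2], by Bernoulli's
   inequality. *)
Definition step (n : nat) (y : R) : R := (1 - y ^+ n) ^+ (2 ^ n).

Lemma step_itv n (y : R) : 0 <= y <= 1 -> 0 <= step n y <= 1.
Proof.
move=> /andP[y0 y1]; have yn0 : 0 <= y ^+ n by rewrite exprn_ge0.
have yn1 : y ^+ n <= 1 by rewrite exprn_ile1.
by rewrite /step exprn_ge0 ?exprn_ile1//; lra.
Qed.

Lemma cvg_step_lt (y : R) : 0 <= y < 1/2 -> step ^~ y @ \oo --> (1 : R).
Proof.
move=> /andP[y0 y1].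
have H : (fun n => 1 - (2 * y) ^+ n) @ \oo --> (1 - 0 : R).
  apply: cvgB; first exact: cvg_cst.
  by apply: cvg_expr; rewrite ger0_norm; lra.
rewrite subr0 in H; apply: (squeeze_cvgr _ H (cvg_cst _)).
apply: nearW => n.
have yn : 0 <= y ^+ n <= 1 by rewrite exprn_ge0// exprn_ile1//; lra.
have /andP[_ ->] := step_itv n y ltac:(apply/andP; split; lra).
rewrite andbT exprMn -natrX; exact: bernoulli_le.
Qed.

(** Since [(1 - y^n) (1 + y^n) <= 1], [step n y] is at most the inverse of [(1 + y^n)^(2^n)], which
    Bernoulli's inequality bounds below by [(2 y)^n]. *)
Lemma cvg_step_gt (y : R) : 1/2 < y <= 1 -> step ^~ y @ \oo --> (0 : R).
Proof.
move=> /andP[y0 y1].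
have H : (fun n => (2 * y)^-1 ^+ n) @ \oo --> (0 : R).
  apply: cvg_expr; rewrite ger0_norm ?invr_ge0; last by lra.
  by rewrite invf_lt1; lra.
apply: (squeeze_cvgr _ (cvg_cst _) H).
apply: nearW => n.
have yn : 0 <= y ^+ n <= 1 by rewrite exprn_ge0// ?exprn_ile1//; lra.
have /andP[-> _] := step_itv n y ltac:(apply/andP; split; lra).
rewrite /=.
have yn0 : 0 < y ^+ n by rewrite exprn_gt0//; lra.
have b := bernoulli_ge (y ^+ n) (2 ^ n) (ltW yn0).
have p0 : 0 < (2 * y) ^+ n by rewrite exprn_gt0//; lra.
rewrite exprVn -[leRHS]mul1r ler_pdivlMr//.
apply: (@le_trans _ _ (step n y * (1 + y ^+ n) ^+ (2 ^ n))).
  apply: ler_wpM2l.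
    by have /andP[] := step_itv n y ltac:(apply/andP; split; lra).
  by apply: le_trans b; rewrite natrX -exprMn; lra.
rewrite /step -exprMn exprn_ile1//; move/andP: yn => [yn1 yn2]; nra.
Qed.
End Step.

Section Approximation.
Context {R : realType}.
Variable a : R.
Hypothesis a0 : 0 < a.
Notation mu := (@lebesgue_measure R).
Let w : R := 2 * pi / a.
Let D : set R := `]0, a[%classic.
Let mD : measurable D := measurable_oa a.
Let Dy : (mu D < +oo)%E := measure_oa_fin a a0.

Definition unit_valued (u : R -> R) : Prop := forall t, 0 <= u t <= 1.

Lemma unit_valued_sub_norm (u v : R -> R) t : unit_valued u -> unit_valued v
    -> `|u t - v t| <= 1.
Proof.
move=> /(_ t) /andP[u0 u1] /(_ t) /andP[v0 v1].
by rewrite ler_norml; apply/andP; split; lra.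
Qed.

Lemma dct_unit (u_ : nat -> R -> R) (u : R -> R) :
  (forall n, bmeas (u_ n)) -> bmeas u ->
  (forall n, unit_valued (u_ n)) ->
  {ae mu, forall t, D t -> u_ ^~ t @ \oo --> u t} ->
  forall e, 0 < e -> exists n, \int[mu]_(t in D) `|u_ n t - u t| <= e.
Proof.
move=> bu_ bu u1 cu e e0.
have [] := @dominated_convergence _ _ R mu D mD (fun n => EFin \o u_ n)
   (EFin \o u) (EFin \o cst 1).
- move=> n; apply/measurable_EFinP; apply: measurable_funS (proj1 (bu_ n)) =>
      //.
- by apply/measurable_EFinP; apply: measurable_funS (proj1 bu).
- case: cu => A [mA A0 sA]; exists A; split => // t h; apply: sA => cu.
  by apply: h => Dt; apply: cvg_EFin; [exact: nearW|exact: cu].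
- by apply: bmeas_integrable => //; exact: bmeas_cst.
- apply: aeW => t n Dt /=; rewrite lee_fin.
  by have /andP[? ?] := u1 n t; rewrite ger0_norm.
move=> _ + _ => /fine_cvgP[_] /cvgrPdist_le/(_ _ e0)[n _ /(_ n (leqnn n))] h.
exists n; apply: le_trans h; rewrite sub0r normrN /Rintegral.
by rewrite ger0_norm ?fine_ge0//; apply: integral_ge0 => t _.
Qed.

(** Approximability in [L^1 (0, a)]. Asking the approximants to stay in [[0, 1]] makes the class
    stable under products and provides a uniform bound later on. *)
Definition apx (u : R -> R) : Prop := forall e, 0 < e ->
  exists P, [/\ tpoly w P, unit_valued P & \int[mu]_(t in D) `|u t - P t| <= e].

Lemma le_Rintegral_period f g : bmeas f -> bmeas g -> (forall t, D t -> f t <=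
    g t) ->
  \int[mu]_(t in D) f t <= \int[mu]_(t in D) g t.
Proof. by move=> bf bg fg; apply: le_Rintegral => //; exact: bmeas_integrable.
    Qed.

Lemma RintegralD_period f g : bmeas f -> bmeas g ->
  \int[mu]_(t in D) (f t + g t) = \int[mu]_(t in D) f t + \int[mu]_(t in D) g t.
Proof. by move=> bf bg; apply: RintegralD => //; exact: bmeas_integrable. Qed.

Lemma apx_lim (u_ : nat -> R -> R) (u : R -> R) :
  (forall n, bmeas (u_ n)) -> bmeas u ->
  (forall n, unit_valued (u_ n)) -> 
  {ae mu, forall t, D t -> u_ ^~ t @ \oo --> u t} ->
  (forall n, apx (u_ n)) -> apx u.
Proof.
move=> bu_ bu u1 cu au e e0.
have e2 : 0 < e / 2 by rewrite divr_gt0.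
have [n un] := dct_unit _ _ bu_ bu u1 cu _ e2.
have [P [tP P1 uP]] := au n _ e2.
exists P; split => //.
have bP := bmeas_tpoly _ _ tP.
have b1 : bmeas (fun t => `|u_ n t - u t|) by exact/bmeas_norm/bmeasB.
have b2 : bmeas (fun t => `|u_ n t - P t|) by exact/bmeas_norm/bmeasB.
apply: (@le_trans _ _ (\int[mu]_(t in D) (`|u_ n t - u t| + `|u_ n t - P t|))).
  apply: le_Rintegral_period.
  - exact/bmeas_norm/bmeasB.
  - exact: bmeasD.
  - by move=> t _; rewrite [X in _ <= X + _]distrC ler_distD.
by rewrite RintegralD_period//; lra.
Qed.

Lemma apxM u v : bmeas u -> bmeas v -> unit_valued u -> unit_valued v ->
  apx u -> apx v -> apx (fun t => u t * v t).
Proof.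
move=> bu bv u1 v1 au av e e0.
have e2 : 0 < e / 2 by rewrite divr_gt0.
have [P [tP P1 uP]] := au _ e2; have [Q [tQ Q1 vQ]] := av _ e2.
exists (fun t => P t * Q t); split.
- exact: tpolyM.
- move=> t; have /andP[? ?] := P1 t; have /andP[? ?] := Q1 t.
  by rewrite mulr_ge0// mulr_ile1.
have bP := bmeas_tpoly _ _ tP; have bQ := bmeas_tpoly _ _ tQ.
have b1 : bmeas (fun t => `|u t - P t|) by exact/bmeas_norm/bmeasB.
have b2 : bmeas (fun t => `|v t - Q t|) by exact/bmeas_norm/bmeasB.
apply: (@le_trans _ _ (\int[mu]_(t in D) (`|u t - P t| + `|v t - Q t|))).
  apply: le_Rintegral_period.
  - by apply/bmeas_norm/bmeasB; exact: bmeasM.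
  - exact: bmeasD.
  - move=> t _; have /andP[p0 p1] := P1 t; have /andP[x0 x1] := v1 t.
    have -> : u t * v t - P t * Q t = (u t - P t) * v t + P t * (v t - Q t) by
        ring.
    apply: le_trans (ler_normD _ _) _; apply: lerD; rewrite normrM.
      by rewrite ler_piMr// ger0_norm.
    by rewrite ler_piMl// ger0_norm.
by rewrite RintegralD_period//; lra.
Qed.

Lemma apx1 : apx (fun=> 1).
Proof.
move=> e e0; exists (fun=> 1); split; first exact: tpoly_cst.
  by move=> t; rewrite ler01 lexx.
under eq_Rintegral do rewrite subrr normr0.
by rewrite Rintegral_cst// mul0r ltW.
Qed.

Variable v : nat -> R -> R.
Hypothesis tv : forall i, tpoly w (v i).
Hypothesis v1 : forall i t, `|v i t| <= 1.
Hypothesis v0 : forall i, countable [set t | D t /\ v i t = 0].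

Let neg i : set R := [set t | v i t < 0].
(** The complement of this set will be the periodic set [U] containing the spectrum: each [v i] will
    be nonnegative on one arc of the cover. *)
Definition neg_all : set R := [set t | forall i, v i t < 0].

Lemma measurable_neg i : measurable (neg i).
Proof.
have [mv _] := bmeas_tpoly _ _ (tv i).
have -> : neg i = v i @^-1` `]-oo, 0[%classic.
  by apply/seteqP; split => t /=; rewrite in_itv.
by rewrite -[X in measurable X]setTI; exact: mv.
Qed.

Lemma measurable_neg_all : measurable neg_all.
Proof.
have -> : neg_all = \bigcap_i neg i.
  by apply/seteqP; split => t /= h; [move=> i _|move=> i]; exact: h.
by apply: bigcap_measurable => // i _; exact: measurable_neg.
Qed.

Lemma unit_indic (A : set R) : unit_valued (\1_A : R -> R).
Proof. by move=> t; rewrite indicE; case: (_ \in _); rewrite ?lexx ?ler01. Qed.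

Lemma apx_neg i : apx (\1_(neg i)).
Proof.
(* [y] takes values in [[1/4, 3/4]] and lies below 1/2 exactly where [v i] is negative, so
   [step n (y t)] tends to the indicator of [neg i] off the countable zero set of [v i]. *)
pose y t := 1 / 2 + 1 / 4 * v i t.
have ty : tpoly w y by apply: tpolyD; [exact: tpoly_cst|exact: tpolyZ].
have y1 t : 0 <= y t <= 1.
  by have := v1 i t; rewrite /y ler_norml => /andP[? ?]; apply/andP; split; lra.
have ts n : tpoly w (fun t => step n (y t)).
  apply: tpolyX; apply: (tpoly_ext _ _ _ (tpolyD _ _ _ (tpoly_cst w 1) (tpolyZ
      w (-1) _ (tpolyX w n _ ty)))).
  by move=> t; rewrite mulN1r.
apply: (apx_lim (fun n t => step n (y t))).
- by move=> n; exact: bmeas_tpoly (ts n).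
- by apply: bmeas_indic; exact: measurable_neg.
- by move=> n t; exact: step_itv.
- exists [set t | D t /\ v i t = 0]; split.
  + exact/countable_measurable.
  + exact: countable_lebesgue_measure0.
  + move=> t /= h; apply/not_notP => h2; apply: h => Dt.
    rewrite indicE; have [vt|vt|vt] := ltgtP (v i t) 0.
    * rewrite mem_set//=; apply: cvg_step_lt.
      by have := y1 t; rewrite /y => /andP[-> _]/=; lra.
    * rewrite memNset/=; last by rewrite /neg/= ltNge (ltW vt).
      apply: cvg_step_gt.
      by have := y1 t; rewrite /y => /andP[_ ->]; rewrite andbT; lra.
    * by exfalso; apply: h2.
- move=> n e e0; exists (fun t => step n (y t)); split => //.
  + by move=> t; exact: step_itv.
  + under eq_Rintegral do rewrite subrr normr0.
    by rewrite Rintegral_cst// mul0r ltW.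
Qed.

Lemma bmeas_prod_neg n : bmeas (fun t => \prod_(i < n) \1_(neg i) t).
Proof.
elim: n => [|n ih].
  by under eq_fun do rewrite big_ord0; exact: bmeas_cst.
under eq_fun do rewrite big_ord_recr/=.
by apply: bmeasM => //; apply: bmeas_indic; exact: measurable_neg.
Qed.

Lemma unit_prod_neg n : unit_valued (fun t => \prod_(i < n) \1_(neg i) t).
Proof.
move=> t; elim: n => [|n /andP[ih1 ih2]]; first by rewrite big_ord0 ler01 lexx.
rewrite big_ord_recr/=; have /andP[? ?] := unit_indic (neg n) t.
by rewrite mulr_ge0// mulr_ile1.
Qed.

Lemma apx_prod_neg n : apx (fun t => \prod_(i < n) \1_(neg i) t).
Proof.
elim: n => [|n ih].
  by under eq_fun do rewrite big_ord0; exact: apx1.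
under eq_fun do rewrite big_ord_recr/=.
apply: apxM => //.
- exact: bmeas_prod_neg.
- by apply: bmeas_indic; exact: measurable_neg.
- exact: unit_prod_neg.
- exact: unit_indic.
- exact: apx_neg.
Qed.

(** The indicator of the countable intersection is the pointwise limit of the finite products, which
    are approximable by [apxM]. *)
Lemma apx_neg_all : apx (\1_neg_all).
Proof.
apply: (apx_lim (fun n t => \prod_(i < n) \1_(neg i) t)).
- exact: bmeas_prod_neg.
- by apply: bmeas_indic; exact: measurable_neg_all.
- exact: unit_prod_neg.
- apply: aeW => t _; rewrite indicE; case: (boolP (t \in neg_all)) => [|].
    move/set_mem => nt.
    have -> : (fun n => \prod_(i < n) \1_(neg i) t) = (fun=> 1 : R).
      apply/funext => n; rewrite big1// => i _.
      by rewrite indicE mem_set//; exact: nt.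
    exact: cvg_cst.
  move/negP => nt; have [i vi] : exists i, ~ neg i t.
    apply/existsNP => h; apply: nt; apply/mem_set => i; exact: h.
  apply: cvg_near_cst; exists i.+1 => // n /= ni.
  rewrite (bigD1 (Ordinal ni))//= indicE.
  by rewrite memNset// mul0r.
- exact: apx_prod_neg.
Qed.
End Approximation.

(** * Approximation from high frequencies *)

Section Key.
Context {R : realType}.
Variable a : R.
Hypothesis a0 : 0 < a.
Notation mu := (@lebesgue_measure R).
Let w : R := 2 * pi / a.
Let D : set R := `]0, a[%classic.
Let mD : measurable D := measurable_oa a.
Let Dy : (mu D < +oo)%E := measure_oa_fin a a0.

(** [P] vanishes on [B] outside a null set [A]. As finite sets are null, [B] minus [A] is infinite,
    and the circle map is injective on [(0, a)]. *)
Lemma tpoly_ae_eq0 P (B : set R) : tpoly w P -> measurable B -> B `<=` D ->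
  (0 < mu B)%E -> \int[mu]_(t in B) (P t * P t) = 0 -> forall t, P t = 0.
Proof.
move=> tP mB BD B0 i0.
have By : (mu B < +oo)%E by apply: le_lt_trans Dy; apply: le_measure; rewrite
    ?inE.
have bPP : bmeas (fun t => P t * P t) by apply: bmeasM; exact: bmeas_tpoly tP.
have iPP := bmeas_integrable _ _ mB By bPP.
have e0 : (\int[mu]_(t in B) `|(P t * P t)%:E| = 0)%E.
  transitivity (\int[mu]_(t in B) (P t * P t)%:E)%E.
    by apply: eq_integral => t _; rewrite gee0_abs// lee_fin -expr2 sqr_ge0.
  have fin : (\int[mu]_(t in B) (P t * P t)%:E)%E \is a fin_num.
    exact: integrable_fin_num.
  by rewrite -(fineK fin); congr EFin.
have mPP : measurable_fun B (fun t => (P t * P t)%:E).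
  by apply/measurable_EFinP; apply: measurable_funS (proj1 bPP).
have [A [mA A0 sA]] := (ae_eq_integral_abs mu mB mPP).1 e0.
apply: (tpoly_eq0 w P (B `\` A)) => //.
- move=> fBA; suff : mu B = 0 by move=> muB; rewrite muB ltxx in B0.
  apply/eqP; rewrite -measure_le0.
  apply: (@le_trans _ _ (mu ((B `\` A) `|` A))).
    apply: le_measure; rewrite ?inE//.
      by apply: measurableU => //; exact: measurableD.
    by move=> t Bt; have [At|At] := pselect (A t); [right|left].
  apply: (le_trans (measureU2 _ _ _)) => //; first exact: measurableD.
  rewrite /= A0 adde0 countable_lebesgue_measure0//.
  exact: finite_set_countable.
- move=> x y /set_mem[Bx _] /set_mem[By' _]; apply: circle_inj => //;
      apply/mem_set; exact: BD.
- move=> t [Bt At]; have : ~ ~ (P t * P t = 0).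
    move=> h; apply: At; apply: sA => /= /(_ Bt)[]; exact: h.
  by move/contrapT/eqP; rewrite mulf_eq0 orbb => /eqP.
Qed.

(* The Gram matrix of the [tb j] on [B] is invertible because [B] has positive
   measure. *)
Lemma tb_moments (B : set R) N (e : nat -> R) : measurable B -> B `<=` D ->
  (0 < mu B)%E ->
  exists d : nat -> R, forall i, (i < N)%N ->
    \int[mu]_(t in B) ((\sum_(j < N) d j * tb w j t) * tb w i t) = e i.
Proof.
move=> mB BD B0.
have By : (mu B < +oo)%E by apply: le_lt_trans Dy; apply: le_measure; rewrite
    ?inE.
pose G : 'M[R]_N := \matrix_(i, j) \int[mu]_(t in B) (tb w i t * tb w j t).
have lin (v : 'rV[R]_N) (f : R -> R) : bmeas f ->
    \int[mu]_(t in B) ((\sum_(j < N) v ord0 j * tb w j t) * f t) =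
    \sum_(j < N) v ord0 j * \int[mu]_(t in B) (tb w j t * f t).
  move=> bf; under eq_Rintegral do rewrite mulr_suml.
  rewrite (Rintegral_sum_bmeas _ _ _ (fun (j : 'I_N) t => v ord0 j * tb w j t
      * f t))//; last first.
    by move=> j; apply: bmeasM => //; apply: bmeasZ; exact: bmeas_tb.
  apply: eq_bigr => j _; under eq_Rintegral do rewrite -mulrA.
  rewrite RintegralZl//; apply: bmeas_integrable => //.
  by apply: bmeasM => //; exact: bmeas_tb.
have tbv (v : 'rV[R]_N) : tpoly w (fun t => \sum_(j < N) v ord0 j * tb w j t).
  by apply: tpoly_sum => j; apply: tpolyZ; exact: tpoly_tb.
have linG (v : 'rV[R]_N) (i : 'I_N) :
    \int[mu]_(t in B) ((\sum_(j < N) v ord0 j * tb w j t) * tb w i t) = (v *m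
        G) ord0 i.
  rewrite lin; last exact: bmeas_tb.
  by rewrite mxE; apply: eq_bigr => j _; rewrite mxE.
have Gu : G \in unitmx.
  rewrite -row_free_unit; apply: inj_row_free => v vG.
  (* If [v *m G = 0], then [T] is orthogonal on [B] to every [tb w j] in its sum, hence to itself,
     so it vanishes everywhere. Orthogonality on the whole period then reads off the entries of [v],
     extended by zero to a sequence [c]. *)
  pose T t := \sum_(j < N) v ord0 j * tb w j t.
  have T0 : forall t, T t = 0.
    apply: (tpoly_ae_eq0 T B) => //; first exact: tbv.
    rewrite /T lin; last exact: bmeas_tpoly (tbv v).
    apply: big1 => j _; under eq_Rintegral do rewrite mulrC.
    by rewrite linG vG mxE mulr0.
  apply/rowP => i; rewrite mxE.
  pose c j := if insub j is Some k then v ord0 (k : 'I_N) else 0.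
  have := int_tb_coef a a0 N c i (ltn_ord i).
  have -> : c i = v ord0 i by rewrite /c valK.
  under eq_Rintegral => t _.
    under eq_bigr => j _ do rewrite /c valK.
    rewrite -/w -/(T t) T0 mul0r.
    over.
  rewrite Rintegral_cst// mul0r => /esym/eqP.
  by rewrite mulf_eq0 (gt_eqF (tbn2_gt0 a a0 i)) orbF => /eqP.
pose dv := (\row_i e i) *m invmx G : 'rV[R]_N.
exists (fun j => if insub j is Some k then dv ord0 (k : 'I_N) else 0) => i iN.
under eq_Rintegral => t _.
  under eq_bigr => j _ do rewrite valK.
  over.
rewrite (linG _ (Ordinal iN)) /dv mulmxKV// mxE.
by [].
Qed.

Variable v : nat -> R -> R.
Hypothesis tv : forall i, tpoly w (v i).
Hypothesis v1 : forall i t, `|v i t| <= 1.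
Hypothesis v0 : forall i, countable [set t | D t /\ v i t = 0].
Hypothesis B0 : (0 < mu (D `&` neg_all v))%E.

(** Choose [T] of degree below [N] such that [T * \1_B] has the same first [N] coefficients as
    [tb w i0], and replace [\1_B] by an approximant [P]. The trigonometric polynomial [T * P] is
    small off [B], and its first [N] coefficients are nearly those of [tb w i0]; correcting them
    leaves [tb w i0] plus terms of index at least [N]. *)
Lemma tb_approx N i0 e : (i0 < N)%N -> 0 < e ->
  exists N' (c : nat -> R),
    \int[mu]_(t in D `\` neg_all v)
      (tb w i0 t + \sum_(N <= i < N') c i * tb w i t) ^+ 2 <= e.
Proof.
move=> i0N e0.
have mB := measurable_neg_all a v tv.
set B := neg_all v in mB *.
have [d dE] := tb_moments (D `&` B) N
  (fun i => if i == i0 then tbn2 a i0 else 0) (measurableI _ _ mD mB)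
  (@subIsetl _ _ _) B0.
set T : R -> R := fun t => \sum_(j < N) d j * tb w j t.
have tT : tpoly w T by exists N, d.
have [C C0 TC] := tpoly_bounded w T tT.
(* [K] will bound the corrected polynomial [Q] off [B], and [s] is the precision asked of [P]; the
   final estimate is [s * W]. *)
pose K := C + N%:R * (2 * C / a).
have K0 : 0 <= K by rewrite addr_ge0// mulr_ge0// divr_ge0 ?mulr_ge0// ltW.
pose W := K * (C * (1 + 2 * N%:R)) + 1.
have W0 : 0 < W by rewrite ltr_wpDl// !mulr_ge0// addr_ge0// mulr_ge0.
pose s := Num.min 1 (e / W).
have s0 : 0 < s by rewrite lt_min ltr01 divr_gt0.
have s1 : s <= 1 by rewrite ge_min lexx.
have sW : s * W <= e by rewrite -ler_pdivlMr// ge_min lexx orbT.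
have [P [tP P1 PB]] := apx_neg_all a a0 v tv v1 v0 s s0.
rewrite -/B -/D in PB.
have tQ := tpolyM w _ _ tT tP.
have [M [p [NM pE]]] := tpoly_coeff w _ N tQ.
have bT := bmeas_tpoly _ _ tT; have bP := bmeas_tpoly _ _ tP.
have bB : bmeas (\1_B) by exact: bmeas_indic.
have bd : bmeas (fun t => `|\1_B t - P t|) by apply: bmeas_norm; exact: bmeasB.
pose del i : R := (i == i0)%:R.
have hp i : (i < N)%N -> `|p i - del i| <= 2 * C / a * s.
  (* [p i] and [del i] are the coefficients of [T * P] and of [T * \1_B]. Their difference is at
     most [C * s] divided by [tbn2 a i], which is at least [a / 2]. *)
  move=> iN; have g0 := tbn2_gt0 a a0 i.
  have ha : a / 2 <= tbn2 a i by rewrite /tbn2; case: ifP => // _; rewrite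
      ler_pdivrMr// ler_peMr ?ler1n ?ltW.
  have E1 : p i * tbn2 a i = \int[mu]_(t in D) (T t * P t * tb w i t).
    rewrite -(int_tb_coef a a0 M p i (leq_trans iN NM)).
    by apply: eq_Rintegral => t _; rewrite pE.
  have E2 : del i * tbn2 a i = \int[mu]_(t in D) (T t * \1_B t * tb w i t).
    transitivity (if i == i0 then tbn2 a i0 else 0).
      by rewrite /del; case: eqP => [->|_]; rewrite ?mul1r ?mul0r.
    rewrite -(dE i iN) Rintegral_mkcondr; apply: eq_Rintegral => t _.
    by rewrite patchE indicE /T; case: ifP => _; rewrite ?mulr1 ?mulr0 ?mul0r.
  have bTP : bmeas (fun t => T t * P t * tb w i t).
    by apply: bmeasM; [exact: bmeasM|exact: bmeas_tb].
  have bTB : bmeas (fun t => T t * \1_B t * tb w i t).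
    by apply: bmeasM; [exact: bmeasM|exact: bmeas_tb].
  have E3 : `|(p i - del i) * tbn2 a i| <= C * s.
    rewrite mulrBl E1 E2 -RintegralB//; last 2 first.
      exact: bmeas_integrable.
      exact: bmeas_integrable.
    apply: le_trans.
      apply: le_normr_Rintegral => //.
      by apply: bmeas_integrable => //; exact: bmeasB.
    apply: (@le_trans _ _ (\int[mu]_(t in D) (C * `|\1_B t - P t|))).
      apply: (le_Rintegral_period a a0).
      - by apply: bmeas_norm; exact: bmeasB.
      - exact: bmeasZ.
      - move=> t _; rewrite -mulrBl -mulrBr !normrM distrC -[leRHS]mulr1.
        by rewrite ler_pM ?mulr_ge0//; [rewrite ler_pM|exact: tb_norm_le1].
    rewrite RintegralZl//; last exact: bmeas_integrable.
    by rewrite ler_wpM2l.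
  rewrite normrM (gtr0_norm g0) in E3.
  have : `|p i - del i| * (a / 2) <= C * s.
    by apply: le_trans E3; rewrite ler_wpM2l.
  rewrite mulrA ler_pdivrMr// -ler_pdivlMr// => h.
  by apply: le_trans h _; rewrite le_eqVlt; apply/orP; left; apply/eqP; ring.
exists M, p.
(* [Q] is [T * P] with its first [N] coefficients corrected to those of [tb w i0], at a uniform cost
   of [N * (2 * C / a) * s]. *)
pose Q t := tb w i0 t + \sum_(N <= i < M) p i * tb w i t.
have QE t : Q t = T t * P t - \sum_(i < N) (p i - del i) * tb w i t.
  rewrite pE -(big_mkord xpredT (fun i => p i * tb w i t)).
  rewrite (big_cat_nat (n := N))//= /Q.
  suff -> : \sum_(i < N) (p i - del i) * tb w i t =
      \sum_(0 <= i < N) p i * tb w i t - tb w i0 t by ring.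
  under eq_bigr do rewrite mulrBl.
  rewrite sumrB big_mkord; congr (_ - _).
  rewrite (bigD1 (Ordinal i0N))//= /del eqxx mul1r big1 ?addr0// => j ji.
  by rewrite (_ : (_ == _) = false) ?mul0r//; apply/negbTE.
have tQ' : tpoly w Q.
  apply: (tpoly_ext w _ _ (tpolyD w _ _ tQ (tpoly_sum w _ (index_enum 'I_N)
      (fun (i : 'I_N) t => (- (p i - del i)) * tb w i t) _))).
    by move=> i; apply: tpolyZ; exact: tpoly_tb.
  move=> t; rewrite QE; congr (_ + _); rewrite -sumrN.
  by apply: eq_bigr => i _; rewrite mulNr.
have bQ := bmeas_tpoly _ _ tQ'.
have sumS t : `|\sum_(i < N) (p i - del i) * tb w i t| <= N%:R * (2 * C / a) *
    s.
  apply: le_trans (ler_norm_sum _ _ _) _.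
  rewrite -mulrA -[N in N%:R]card_ord mulr_natl -sumr_const; apply: ler_sum =>
      i _.
  rewrite normrM -[leRHS]mulr1 ler_pM ?tb_norm_le1//.
  exact: hp.
have Qle t : ~ B t -> `|Q t| <= C * `|\1_B t - P t| + N%:R * (2 * C / a) * s.
  move=> Bt; rewrite QE; apply: le_trans (ler_normB _ _) _; apply: lerD => //.
  rewrite indicE memNset// sub0r normrN normrM.
  by rewrite ler_wpM2r.
have QK t : ~ B t -> `|Q t| <= K.
  move=> Bt; apply: le_trans (Qle t Bt) _; apply: lerD.
    by rewrite ler_piMr//; apply: (unit_valued_sub_norm (\1_B) P) => //;
        exact: unit_indic.
  by rewrite ler_piMr// mulr_ge0// divr_ge0 ?mulr_ge0// ltW.
(* Off [B], [Q^2] is at most [K] times [|Q|]; this turns the [L^1] closeness of [P] to the indicator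
   into an [L^2] estimate. *)
pose m t := K * (C * `|\1_B t - P t| + N%:R * (2 * C / a) * s).
have bm : bmeas m by apply: bmeasZ; apply: bmeasD; [exact: bmeasZ|exact:
    bmeas_cst].
have mDB : measurable (D `\` B) by exact: measurableD.
have DBy : (mu (D `\` B) < +oo)%E.
  by apply: le_lt_trans Dy; apply: le_measure; rewrite ?inE//; exact: subDsetl.
apply: (@le_trans _ _ (\int[mu]_(t in D `\` B) m t)).
  apply: le_Rintegral => //.
  - apply: bmeas_integrable => //; rewrite -/Q.
    by under eq_fun do rewrite expr2; exact: bmeasM.
  - exact: bmeas_integrable.
  - move=> t [_ Bt]; rewrite -/(Q t) -real_normK ?num_real// expr2 /m.
    by apply: ler_pM => //; [exact: QK|exact: Qle].
apply: (@le_trans _ _ (\int[mu]_(t in D) m t)).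
  rewrite /Rintegral fine_le//.
  - by apply: integrable_fin_num => //; exact: bmeas_integrable.
  - by apply: integrable_fin_num => //; exact: bmeas_integrable.
  - apply: ge0_subset_integral => //.
    + by apply/measurable_EFinP; apply: measurable_funS (proj1 bm).
    + have n0 : 0 <= N%:R * (2 * C / a) * s by rewrite !mulr_ge0// ?invr_ge0
          ltW.
      by move=> t _; rewrite lee_fin /m mulr_ge0// addr_ge0// mulr_ge0.
rewrite /m RintegralZl//; last first.
  by apply: bmeas_integrable => //; apply: bmeasD; [exact: bmeasZ|exact:
      bmeas_cst].
rewrite (RintegralD_period a a0); [|exact: bmeasZ|exact: bmeas_cst].
rewrite RintegralZl//; last exact: bmeas_integrable.
rewrite Rintegral_cst//= (measure_oa a a0)/=.
apply: le_trans sW.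
have : C * \int[mu]_(t in D) `|\1_B t - P t| + N%:R * (2 * C / a) * s * a
   <= C * (1 + 2 * N%:R) * s.
  have -> : N%:R * (2 * C / a) * s * a = C * (2 * N%:R) * s.
    by field; rewrite gt_eqF.
  have : C * \int[mu]_(t in D) `|\1_B t - P t| <= C * s by rewrite ler_wpM2l.
  by nra.
move=> /(ler_wpM2l K0)/le_trans; apply.
by rewrite /W; nra.
Qed.
End Key.

(** * Covering of the periodized spectrum *)

Section Period.
Context {R : realType}.
Variable a : R.
Hypothesis a0 : 0 < a.
Let w : R := 2 * pi / a.

Lemma tb_addn i t n : tb w i (t + n%:R * a) = tb w i t.
Proof.
have e : (uphalf i)%:R * (w * (t + n%:R * a)) =
    (uphalf i)%:R * (w * t) + (pi *+ 2) *+ (uphalf i * n).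
  have -> : (pi *+ 2) *+ (uphalf i * n) = (uphalf i * n)%:R * (2 * pi) :> R.
    by rewrite -[LHS]mulr_natl -[pi *+ 2]mulr_natl.
  rewrite natrM /w.
  by field; rewrite gt_eqF.
rewrite /tb; case: (odd i); rewrite e.
  by rewrite (periodicn (@sinD2pi R)).
by rewrite (periodicn (@cosD2pi R)).
Qed.

Lemma tpoly_periodic P t (k : int) : tpoly w P -> P (t + k%:~R * a) = P t.
Proof.
move=> [N [c Pc]]; rewrite !Pc; apply: eq_bigr => i _; congr (_ * _).
case: k => n; first by rewrite tb_addn.
have -> : (Negz n)%:~R = - n.+1%:R :> R by rewrite NegzE mulrNz.
by rewrite mulNr -[LHS](tb_addn _ _ n.+1) subrK.
Qed.
End Period.

Section Cover.
Context {R : realType}.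
Variable a : R.
Hypothesis a0 : 0 < a.
Notation mu := (@lebesgue_measure R).
Let w : R := 2 * pi / a.
Let D : set R := `]0, a[%classic.
Let mD : measurable D := measurable_oa a.
Let Dy : (mu D < +oo)%E := measure_oa_fin a a0.

(* The product of sines is an [a]-periodic trigonometric polynomial which, for
   [0 <= x <= y <= a], is nonnegative on [(0, a)] exactly between [x] and [y].
       *)
Definition arc (x y t : R) : R :=
  if x <= y then sin (pi / a * (t - x)) * sin (pi / a * (y - t)) else -1.

(** Each sine has half the base frequency, but their product is half of [cos (w t - c)] minus a
    constant, with [c = (pi / a) (x + y)]. *)
Lemma tpoly_arc x y : tpoly w (arc x y).
Proof.
rewrite /arc; case: (x <= y); last exact: tpoly_cst.
have tc := tpoly_cos w 1; have ts := tpoly_sin w 1.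
pose c := pi / a * (x + y).
apply: (tpoly_ext _ _ _ (tpolyD _ _ _ (tpolyZ _ (1/2 * cos c) _ tc)
  (tpolyD _ _ _ (tpolyZ _ (1 / 2 * sin c) _ ts)
     (tpoly_cst w (- (1 / 2 * cos (pi / a * (y - x)))))))) => t.
have e1 : 1%:R * (w * t) - c = pi / a * (t - x) - pi / a * (y - t).
  by rewrite /w /c; ring.
have e2 : pi / a * (y - x) = pi / a * (t - x) + pi / a * (y - t) by ring.
have := cosB (1%:R * (w * t)) c; rewrite e1 e2 cosB cosD => h.
set A := cos (_ * (w * t)) in h *; set B := sin (_ * (w * t)) in h *.
move: h; set X1 := cos _; set X2 := cos _; set Y1 := sin _; set Y2 := sin _ =>
    h.
have -> : 1 / 2 * cos c * A + (1 / 2 * sin c * B - 1 / 2 * (X1 * X2 - Y1 *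
    Y2)) =
   1 / 2 * (A * cos c + B * sin c) - 1 / 2 * (X1 * X2 - Y1 * Y2) by ring.
by rewrite -h; lra.
Qed.

Lemma arc_norm_le1 x y t : `|arc x y t| <= 1.
Proof.
rewrite /arc; case: ifP => _; last by rewrite normrN1.
by rewrite normrM mulr_ile1// sin_max.
Qed.

Lemma sin_scaled_ge0 u : 0 <= u <= a -> 0 <= sin (pi / a * u).
Proof.
move=> /andP[u0 ua]; apply: sin_ge0_pi; have p := pi_gt0 R.
have pa : 0 < pi / a by rewrite divr_gt0.
rewrite mulr_ge0//=; last exact: ltW.
by rewrite mulrAC ler_pdivrMr// ler_pM2l.
Qed.

Lemma sin_scaled_gt0 u : 0 < u < a -> 0 < sin (pi / a * u).
Proof.
move=> /andP[u0 ua]; apply: sin_gt0_pi; have p := pi_gt0 R.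
have pa : 0 < pi / a by rewrite divr_gt0.
rewrite mulr_gt0//=.
by rewrite mulrAC ltr_pdivrMr// ltr_pM2l.
Qed.

Lemma sin_scaled_lt0 u : - a < u < 0 -> sin (pi / a * u) < 0.
Proof.
move=> /andP[ua u0]; rewrite -oppr_gt0 -sinN -mulrN.
by apply: sin_scaled_gt0; lra.
Qed.

Lemma arc_ge0 (x y t : R) : 0 <= x -> y <= a -> x <= t <= y -> 0 <= arc x y t.
Proof.
move=> x0 ya /andP[xt ty]; rewrite /arc (le_trans xt ty).
by apply: mulr_ge0; apply: sin_scaled_ge0; lra.
Qed.

Lemma arc_lt0 (x y t : R) : 0 <= x -> y <= a -> D t ->
  (t < x \/ y < t \/ y < x) -> arc x y t < 0.
Proof.
move=> x0 ya; rewrite /D/= in_itv/= => /andP[t0 ta] h.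
rewrite /arc; case: (leP x y) => [xy|_]; last exact: ltrN10.
case: h => [tx|[yt|]]; last by rewrite ltNge xy.
  by rewrite nmulr_rlt0; [apply: sin_scaled_gt0|apply: sin_scaled_lt0]; lra.
by rewrite pmulr_rlt0; [apply: sin_scaled_lt0|apply: sin_scaled_gt0]; lra.
Qed.

Lemma arc_gt0 (x y t : R) : 0 <= x -> y <= a -> D t -> x < t -> t < y -> 0 <
    arc x y t.
Proof.
move=> x0 ya; rewrite /D/= in_itv/= => /andP[t0 ta] xt ty.
rewrite /arc (ltW (lt_trans xt ty)).
by apply: mulr_gt0; apply: sin_scaled_gt0; lra.
Qed.

Lemma arc_zeros (x y : R) : 0 <= x -> y <= a -> countable [set t | D t /\ arc
    x y t = 0].
Proof.
move=> x0 ya; apply: (@sub_countable _ _ _ [set x; y]); last first.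
  exact: finite_set_countable.
apply: subset_card_le => t /= [Dt ar0].
have [tx|xt|->] := ltgtP t x; last by left.
  by have := arc_lt0 x y t x0 ya Dt (or_introl tx); rewrite ar0 ltxx.
have [ty|yt|->] := ltgtP t y; last by right.
  by have := arc_gt0 x y t x0 ya Dt xt ty; rewrite ar0 ltxx.
by have := arc_lt0 x y t x0 ya Dt (or_intror (or_introl yt)); rewrite ar0 ltxx.
Qed.

(* [leb] is an outer measure, so a cover of [S_per S a] by intervals of total
   length [< a] exists without measurability of [S_per S a]. *)
Lemma per_cover (S : set R) : (leb (S_per S a : set (LebT R)) < a%:E)%E ->
  exists v : nat -> R -> R,
    [/\ (forall i, tpoly w (v i)), (forall i t, `|v i t| <= 1),
        (forall i, countable [set t | D t /\ v i t = 0]),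
        (0 < mu (D `&` neg_all v))%E &
        (forall t, S t -> ~ neg_all v t)].
Proof.
move=> /ereal_inf_lt[_ [A [mA SA] <-] sA].
have H i : exists p : R * R, A i = `]p.1, p.2]%classic.
  by have [p _ <-] := mA i; exists p.
have [p pE] := choice H.
(* The covering intervals are clipped to [[0, a]]. One that misses [[0, a]] gives [y i < x i], where
   [arc] is the constant -1 and [C i] is empty. *)
pose x i := Num.max (p i).1 0; pose y i := Num.min (p i).2 a.
have x0 i : 0 <= x i by rewrite le_max lexx orbT.
have ya i : y i <= a by rewrite ge_min lexx orbT.
pose v i := arc (x i) (y i).
have tv i : tpoly w (v i) by exact: tpoly_arc.
exists v; split => //.
- by move=> i t; exact: arc_norm_le1.
- by move=> i; exact: arc_zeros.
- have mB := measurable_neg_all a v tv.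
  rewrite lt0e measure_ge0 andbT; apply/eqP => B0.
  pose C i : set R := if x i <= y i then `[x i, y i]%classic else set0.
  have mC i : measurable (C i) by rewrite /C; case: ifP.
  have DC : D `\` neg_all v `<=` \bigcup_i C i.
    move=> t [Dt /existsNP[i /negP]]; rewrite -leNgt => vt; exists i => //.
    rewrite /C; case: (leP (x i) (y i)) => [xy|yx].
      rewrite /= in_itv/=; apply/andP; split; rewrite leNgt; apply/negP => h.
        by have := arc_lt0 _ _ _ (x0 i) (ya i) Dt (or_introl h); rewrite ltNge
            vt.
      by have := arc_lt0 _ _ _ (x0 i) (ya i) Dt (or_intror (or_introl h));
          rewrite ltNge vt.
    by have := arc_lt0 _ _ _ (x0 i) (ya i) Dt (or_intror (or_intror yx));
        rewrite ltNge vt.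
  have CA i : (mu (C i) <= wlength idfun (A i))%E.
    rewrite /C pE; case: (leP (x i) (y i)) => xy; last first.
      by rewrite measure0; apply: wlength_itv_ge0.
    have xp : (p i).1 <= x i by rewrite le_max lexx.
    have yp : y i <= (p i).2 by rewrite ge_min lexx.
    have pp : (p i).1 <= (p i).2 by apply: le_trans xp (le_trans xy yp).
    rewrite wlength_itv_bnd// lebesgue_measure_itv/= lte_fin.
    case: ifP => _; last by rewrite lee_fin subr_ge0.
    by rewrite -EFinD lee_fin lerB.
  (* If [neg_all v] met [D] in a null set, the arcs [C i] would cover [D] up to a null set and the
     lengths of the cover would sum to at least [a]. *)
  have : (mu D <= \sum_(k <oo) wlength idfun (A k))%E.
    apply: (@le_trans _ _ (mu (D `\` neg_all v) + mu (D `&` neg_all v))%E).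
      rewrite -measureU//; last 3 first.
        exact: measurableD.
        exact: measurableI.
        by rewrite setDE setIACA setICl setI0.
      by rewrite setUC setUIDK.
    rewrite B0 adde0.
    apply: le_trans (lee_nneseries _ _) => //; last by move=> i _; exact: CA.
      by apply: measure_sigma_subadditive => //; exact: measurableD.
    by move=> i _ _; exact: measure_ge0.
  by rewrite measure_oa// leNgt sA.
- move=> s Ss neg.
  (* [s] is reduced modulo [a] to a point [t] of [S_per S a]. An interval of the cover contains [t],
     so the corresponding arc is nonnegative there, and periodicity carries this back to [s]. *)
  pose k : int := - Num.floor (s / a).
  pose t := s + k%:~R * a.
  have tS : S_per S a t.
    split; last by exists s, k.
    have := floor_itv (s / a); rewrite /t /k mulrNz mulNr => /andP[h1 h2].
    rewrite ler_pdivlMr// in h1; rewrite ltr_pdivrMr// intrD mulrDl mul1r in h2.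
    by apply/andP; split; lra.
  have [i _] := SA t tS; rewrite pE /= in_itv/= => /andP[pt tp].
  have [/andP[t0 ta] _] := tS.
  have := neg i; rewrite -(tpoly_periodic a a0 (v i) s k (tv i)) -/t ltNge.
  rewrite arc_ge0//; apply/andP; split.
    by rewrite /x ge_max t0 (ltW pt).
  by rewrite /y le_min tp ta.
Qed.
End Cover.

(** * Perturbed lattices *)

Section PerturbedLattice.
Context {R : realType}.
Variable a : R.
Hypothesis a0 : 0 < a.
Variable xi : int -> R.
Hypothesis xi_itv : forall n, 0 <= a * xi n <= 1.
Hypothesis xi_step : forall n : int, a * `|xi (n + 1) - xi n| <= 1 / 2.

Let p (n : int) : R := n%:~R / a + xi n.

Let apE n : a * p n = n%:~R + a * xi n.
Proof. by rewrite /p; field; rewrite gt_eqF. Qed.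

(** In units of [1 / a], neighbours are [1] apart up to a change of shift of at most [1 / 2]; other
    pairs are at least [2] apart before shifts that differ by at most [1]. *)
Lemma lattice_gap (n m : int) : n < m -> 1 / 2 <= a * p m - a * p n.
Proof.
move=> nm; rewrite !apE.
have [->|nm1] := eqVneq m (n + 1).
  rewrite intrD; have := xi_step n.
  rewrite -{1}(gtr0_norm a0) -normrM mulrBr ler_norml => /andP[h1 h2].
  by lra.
have nm2 : n + 2 <= m by lia.
have : (n + 2)%:~R <= m%:~R :> R by rewrite ler_int.
have /andP[h1 h2] := xi_itv n; have /andP[h3 h4] := xi_itv m.
by rewrite intrD; lra.
Qed.

Lemma lattice_incr (n m : int) : (p n < p m) = (n < m).
Proof.
have h k l : k < l -> p k < p l.
  move=> /lattice_gap; rewrite -mulrBr => h.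
  by rewrite -subr_gt0 -(pmulr_rgt0 _ a0); lra.
have [nm|mn|->] := ltgtP n m.
- exact: h.
- by apply/negbTE; rewrite -leNgt ltW// h.
- by rewrite ltxx.
Qed.

Lemma int_threshold (Q : int -> Prop) lo (d : nat) :
  ~ Q lo -> Q (lo + d%:Z) -> exists n, ~ Q n /\ Q (n + 1).
Proof.
elim: d => [|d ih] nQ; first by rewrite addr0.
have [Qd|nQd] := pselect (Q (lo + d%:Z)); first by move=> _; exact: ih.
by move=> h; exists (lo + d%:Z); split => //; rewrite -addrA -PoszD addn1.
Qed.

(** [Q] is left free when [p n = y], so that both [x < p n] and [x + r <= p n] are covered, as the
    open window requires. *)
Lemma lattice_threshold (Q : int -> Prop) (y : R) :
  (forall n, p n < y -> ~ Q n) -> (forall n, y < p n -> Q n) ->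
  exists n, ~ Q n /\ Q (n + 1).
Proof.
move=> h1 h2.
have /andP[f1 f2] := floor_itv (a * y); rewrite intrD in f2.
(* Since [a * p n] lies in [[n, n + 1]], the point of index [floor (a y) - 2] is below [y] and the
   one five indices later is above it. *)
apply: (@int_threshold _ (Num.floor (a * y) - 2) 5).
  apply: h1; rewrite -(ltr_pM2l a0) apE.
  by have /andP[_ h] := xi_itv (Num.floor (a * y) - 2); rewrite intrD; lra.
apply: h2; rewrite -(ltr_pM2l a0) apE.
have /andP[h _] := xi_itv (Num.floor (a * y) - 2 + 5%:Z).
by rewrite !intrD; lra.
Qed.

Lemma lattice_discrete : uniformly_discrete [set p n | n in [set: int]].
Proof.
exists (1 / 2 / a); first by rewrite divr_gt0//; lra.
move=> _ _ [n _ <-] [m _ <-].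
wlog nm : n m / n < m => [H|_].
  have [nm|mn|-> //] := ltgtP n m; first exact: H.
  by move=> h; rewrite distrC; apply: H => // e; exact: h.
rewrite ler_pdivrMr// [leRHS]mulrC distrC -{1}(gtr0_norm a0) -normrM mulrBr.
by apply: le_trans (ler_norm _); exact: lattice_gap.
Qed.

Lemma lattice_window (x r : R) : 0 < r ->
  exists m : nat, card_in_window [set p n | n in [set: int]] x r m /\
    `|m%:R - r * a| <= 2.
Proof.
move=> r0.
(* [n1] is the last index with [p n1 <= x] and [n2] the last with [p n2 < x + r], so the window
   holds exactly the points of indices [n1 + 1] to [n2]. *)
have [n1 [/negP]] : exists n, ~ (x < p n) /\ x < p (n + 1).
  by apply: (lattice_threshold _ x) => // n /ltW; rewrite leNgt => /negP.
rewrite -leNgt => l1 g1.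
have [n2 [/negP]] : exists n, ~ (x + r <= p n) /\ x + r <= p (n + 1).
  apply: (lattice_threshold _ (x + r)) => n; last exact: ltW.
  by rewrite ltNge => /negP.
rewrite -ltNge => l2 g2.
have n12 : n1 <= n2.
  by rewrite -ltzD1 -lattice_incr; lra.
pose m := `|n2 - n1|%N.
have mE : m%:Z = n2 - n1 by rewrite /m gez0_abs// subr_ge0.
exists m; split.
  exists [seq p (n1 + i.+1%:Z) | i <- iota 0 m]; split; [|split].
  - rewrite map_inj_in_uniq ?iota_uniq// => i j _ _ e.
    have := lattice_incr (n1 + i.+1%:Z) (n1 + j.+1%:Z).
    have := lattice_incr (n1 + j.+1%:Z) (n1 + i.+1%:Z).
    by rewrite e ltxx; lia.
  - by rewrite size_map size_iota.
  - move=> y; split.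
      move=> /mapP[j]; rewrite mem_iota add0n => /= im ->; split; first by
          exists (n1 + j.+1%:Z).
      apply/andP; split.
        apply: lt_le_trans g1 _; rewrite leNgt lattice_incr -leNgt; lia.
      apply: le_lt_trans l2; rewrite leNgt lattice_incr -leNgt; lia.
    move=> [[n _ <-] /andP[h1 h2]].
    have nn1 : n1 < n by rewrite -lattice_incr; lra.
    have nn2 : n <= n2 by rewrite -ltzD1 -lattice_incr; lra.
    apply/mapP; exists (`|(n - n1 - 1)%R|%N).
      by rewrite mem_iota add0n; apply/andP; split => //; lia.
    by congr p; lia.
have mR : m%:R = n2%:~R - n1%:~R :> R.
  by rewrite -intrB -mE.
have := xi_itv n1; have := xi_itv n2; have := xi_itv (n1 + 1); have := xi_itv
    (n2 + 1).
move: l1 g1 l2 g2.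
rewrite -(ler_pM2l a0 (p n1)) -(ler_pM2l a0 (x + r)) -(ltr_pM2l a0 x)
    -(ltr_pM2l a0 (p n2)).
rewrite !apE !intrD mulrDr.
move=> l1 g1 l2 g2 /andP[? ?] /andP[? ?] /andP[? ?] /andP[? ?].
by rewrite mR ler_norml; apply/andP; split; lra.
Qed.

Lemma lattice_density : has_uniform_density [set p n | n in [set: int]] a.
Proof.
move=> e e0; exists (2 / e) => r re x.
have r0 : 0 < r by apply: lt_trans re; rewrite divr_gt0.
have [m [cm hm]] := lattice_window x r r0.
exists m; split => //; apply: le_trans hm _.
by rewrite mulrC -ler_pdivrMr// ltW.
Qed.
End PerturbedLattice.

Lemma block_lattice {R : realType} (a : R) (M : nat -> nat) (X : nat -> R) :
  0 < a -> M 0%N = 0%N -> (forall k, M k < M k.+1)%N ->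
  (forall k, 0 <= a * X k <= 1) ->
  exists L : set R, [/\ uniformly_discrete L, has_uniform_density L a &
    forall k (n : int), (M k < `|n|%N < M k.+1)%N -> L (n%:~R / a + X k)].
Proof.
move=> a0 M0 Mlt Xitv.
have Mhomo : {homo M : i j / (i < j)%N}.
  by apply: homo_ltn => //; exact: ltn_trans.
have Mle k : (k <= M k)%N.
  by elim: k => // k ih; apply: leq_ltn_trans ih (Mlt k).
have H n : exists k, (M k <= n < M k.+1)%N.
  have [d] : exists d, (n < M d)%N by exists n.+1; exact: Mle.
  elim: d => [|d ih]; first by rewrite M0.
  by have [/ih//|dn nd] := ltnP n (M d); exists d; rewrite dn nd.
have [kk kkP] := choice H.
have kkE n k : (M k <= n < M k.+1)%N -> kk n = k.
  move=> /andP[h1 h2]; have /andP[h3 h4] := kkP n.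
  apply/eqP; rewrite eqn_leq; apply/andP; split; rewrite leqNgt; apply/negP =>
      h.
    have : (M k.+1 <= M (kk n))%N.
      by move: h; rewrite leq_eqVlt => /predU1P[->//|/Mhomo/ltnW].
    lia.
  have : (M (kk n).+1 <= M k)%N.
    by move: h; rewrite leq_eqVlt => /predU1P[->//|/Mhomo/ltnW].
  lia.
(* At the first index of a block the shift is the midpoint of [[0, 1 / a]], within [1 / (2 a)] of
   every admissible shift. This caps the jump between blocks and explains the strict lower bound on
   [|n|] in the conclusion. *)
pose eta (n : nat) := if n == M (kk n) then 1 / 2 / a else X (kk n).
pose xi (n : int) := eta `|n|%N.
have half : a * (1 / 2 / a) = 1 / 2 by field; rewrite gt_eqF.
have eta_itv n : 0 <= a * eta n <= 1.
  by rewrite /eta; case: ifP => // _; rewrite half; lra.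
have xi_itv n : 0 <= a * xi n <= 1 by exact: eta_itv.
have eta_step n : a * `|eta n.+1 - eta n| <= 1 / 2.
  rewrite -{1}(gtr0_norm a0) -normrM mulrBr.
  have /andP[e1 e2] := eta_itv n; have /andP[e3 e4] := eta_itv n.+1.
  have /andP[k1 k2] := kkP n.
  have [nM|nM] := eqVneq n (M (kk n)).
    have -> : a * eta n = 1 / 2 by rewrite /eta -nM eqxx.
    by rewrite ler_norml; lra.
  have [nM1|nM1] := eqVneq n.+1 (M (kk n.+1)).
    have -> : a * eta n.+1 = 1 / 2 by rewrite /eta -nM1 eqxx.
    by rewrite ler_norml; lra.
  have e : kk n.+1 = kk n.
    apply: (kkE); rewrite (leq_trans k1 (leqnSn _))/= ltn_neqAle k2 andbT.
    apply/negP => /eqP e; move/negP: nM1; apply; apply/eqP.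
    rewrite (kkE n.+1 (kk n).+1)//; rewrite -e leqnn/= e; exact: Mlt.
  by rewrite /eta (negbTE nM) (negbTE nM1) e subrr normr0 divr_ge0.
have xi_step (n : int) : a * `|xi (n + 1) - xi n| <= 1 / 2.
  rewrite /xi; have [n0|n0] := leP 0 n.
    have -> : `|(n + 1)%R|%N = `|n|%N.+1 by lia.
    exact: eta_step.
  have -> : `|n|%N = `|(n + 1)%R|%N.+1 by lia.
  by rewrite distrC; exact: eta_step.
exists [set n%:~R / a + xi n | n in [set: int]]; split.
- exact: lattice_discrete.
- exact: lattice_density.
- move=> k n /andP[h1 h2]; exists n => //; congr (_ + _).
  rewrite /xi /eta (kkE _ k) ?(ltnW h1)//.
  by rewrite gtn_eqF.
Qed.

(** * Completed Lebesgue measure and the weight *)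

Section Transfer.
Context {R : realType}.
Notation mu := (@lebesgue_measure R).

Lemma borel_leb_measurable (A : set R) : measurable A -> @measurable _ (LebT
    R) A.
Proof. exact: sub_caratheodory. Qed.

Lemma borel_leb_measurable_fun d (T : measurableType d) (f : R -> T) :
  measurable_fun setT f -> measurable_fun (T := LebT R) setT f.
Proof.
move=> mf _ Y mY; rewrite setTI; apply: borel_leb_measurable.
by rewrite -[X in measurable X]setTI; exact: mf.
Qed.

(** The identity is measurable from [LebT R] to the Borel line and pushes [leb] forward to [mu]. *)
Lemma integral_leb (f : R -> \bar R) : measurable_fun setT f ->
  (forall t, 0 <= f t)%E ->
  (\int[@leb R]_(t in setT) f t = \int[mu]_t f t)%E.
Proof.
move=> mf f0.
have mid : measurable_fun (T := LebT R) (U := measurableTypeR R) setT idfun.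
  by move=> _ Y mY; rewrite setTI; exact: (borel_leb_measurable Y).
have := @ge0_integral_pushforward _ _ (LebT R) (measurableTypeR R) R idfun mid
    (@leb R)
  setT f measurableT mf (fun t _ => f0 t).
rewrite preimage_setT => <-.
by apply: eq_measure_integral => A mA _.
Qed.

(** By uniqueness of the measure that gives half-open intervals their length. *)
Lemma lebesgue_measure_shift (c : R) (A : set R) : measurable A ->
  mu ((fun t => t + c) @^-1` A) = mu A.
Proof.
move=> mA.
have ms : measurable_fun (T := measurableTypeR R) (U := measurableTypeR R)
    setT (fun t => t + c).
  exact: measurable_funD.
suff H : forall X, ocitv X -> mu X = pushforward mu (fun t : measurableTypeR R
    => t + c : measurableTypeR R) X.
  have := @lebesgue_measure_unique R (pushforward mu (fun t : measurableTypeR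
      R => t + c : measurableTypeR R)) H A mA.
  by move=> /(_ ms) ->.
move=> X [[x y] _ <-] /=; rewrite /pushforward.
rewrite (_ : _ @^-1` _ = `](x - c), (y - c)]%classic); last first.
  by apply/seteqP; split => t /=; rewrite !in_itv/= => /andP[? ?]; apply/andP;
      split; lra.
by rewrite !lebesgue_measure_itv/= !lte_fin ltrD2r -!EFinD; case: ifP => // _;
    congr EFin; lra.
Qed.

Lemma integral_shift (c : R) (f : R -> \bar R) (E : set R) :
  measurable E -> measurable_fun setT f -> (forall t, 0 <= f t)%E ->
  (\int[mu]_(t in (fun t => t + c)%R @^-1` E) f (t + c)%R = \int[mu]_(t in E)
      f t)%E.
Proof.
move=> mE mf f0.
have ms : measurable_fun (T := measurableTypeR R) (U := measurableTypeR R)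
    setT (fun t => t + c).
  exact: measurable_funD.
have := @ge0_integral_pushforward _ _ (measurableTypeR R) (measurableTypeR R)
    R _ ms mu
  E f mE (measurable_funS measurableT (@subsetT _ _) mf) (fun t _ => f0 t).
move=> <-.
apply: (@eq_measure_integral _ _ _ _ mu (pushforward mu (fun t :
    measurableTypeR R => t + c : measurableTypeR R))) => A mA _.
exact: lebesgue_measure_shift.
Qed.
End Transfer.

(** * Summability of the inverse weight over the translates of a period *)

Section PSeries.
Context {R : realType}.

(** With [x = k + 1] and [y = k + 2], [ln x <= ln y - 1 / y] gives [x^(-s) >= y^(-s) e^(s / y)], and
    [e^u >= 1 + u] concludes. *)
Lemma powR_telescope (s : R) (k : nat) : 0 < s ->
  s * (k.+2%:R `^ (1 + s))^-1 <= k.+1%:R `^ (- s) - k.+2%:R `^ (- s).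
Proof.
move=> s0; set x : R := k.+1%:R; set y : R := k.+2%:R.
have x0 : 0 < x by rewrite ltr0n.
have y0 : 0 < y by rewrite ltr0n.
have xy : x = y * (1 - y^-1).
  by rewrite mulrBr mulfV ?gt_eqF// mulr1 /x /y -[k.+2%:R]natr1 addrK.
have y1 : y^-1 < 1 by rewrite invf_lt1// ltr1n.
have lnx : ln x <= ln y - y^-1.
  rewrite xy lnM ?posrE//; last by rewrite subr_gt0.
  by rewrite lerD2l; apply: le_ln1Dx; rewrite ltrN2.
have -> : (y `^ (1 + s))^-1 = y `^ (- s) * y^-1.
  by rewrite powRD ?(gt_eqF y0) ?implybT// powRr1 ?ltW// invfM powRN mulrC.
rewrite lerBrDr.
have -> : s * (y `^ (- s) / y) + y `^ (- s) = y `^ (- s) * (1 + s * y^-1) by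
    ring.
apply: (@le_trans _ _ (y `^ (- s) * expR (s * y^-1))).
  by rewrite ler_wpM2l ?powR_ge0// expR_ge1Dx.
rewrite /powR (gt_eqF x0) (gt_eqF y0) -expRD ler_expR.
have := ler_wpM2l (ltW s0) lnx; rewrite mulrBr !mulNr lerNr opprD opprK. by [].
Qed.

Lemma sum_powR_le (s : R) (n : nat) : 0 < s ->
  \sum_(k < n) (k.+1%:R `^ (1 + s))^-1 <= 1 + s^-1.
Proof.
move=> s0.
(* The extra term bounds the tail of the series; with it the left side is nonincreasing in [m] and
   the induction closes. *)
suff H m : \sum_(k < m.+1) (k.+1%:R `^ (1 + s))^-1 + s^-1 * m.+1%:R `^ (- s)
    <= 1 + s^-1.
  case: n => [|n]; first by rewrite big_ord0 addr_ge0// invr_ge0 ltW.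
  apply: le_trans (H n); rewrite lerDl mulr_ge0 ?powR_ge0// invr_ge0 ltW//.
elim: m => [|m ih].
  by rewrite big_ord1 !powR1 invr1 mulr1.
rewrite big_ord_recr/=; apply: le_trans ih; rewrite -addrA lerD2l.
have := powR_telescope s m s0; rewrite -ler_pdivlMl// => h.
by rewrite mulrBr in h; lra.
Qed.

Variables (a alpha : R).
Hypothesis a0 : 0 < a.
Hypothesis al : 1 / 2 < alpha.

Definition weight (t : R) : R := 1 + `|t| `^ (2 * alpha).

Lemma weight_gt0 t : 0 < weight t.
Proof. by rewrite ltr_wpDr// powR_ge0. Qed.

Lemma measurable_weight : measurable_fun setT weight.
Proof.
apply: measurable_funD => //.
by apply: (@measurableT_comp _ _ _ _ _ _ (@powR R ^~ (2 * alpha))) => //.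
Qed.

Lemma measurable_weightV : measurable_fun setT (fun t => (weight t)^-1).
Proof.
have -> : (fun t => (weight t)^-1) = (fun t => weight t `^ (-1)).
  by apply/funext => t; rewrite powR_inv1// ltW// weight_gt0.
apply: (@measurableT_comp _ _ _ _ _ _ (@powR R ^~ (-1))).
  exact: measurable_powR.
exact: measurable_weight.
Qed.

Let cell_weight (k : nat) : R := (weight (k%:R * a))^-1.

Lemma cell_weight_ge0 k : 0 <= cell_weight k.
Proof. by rewrite invr_ge0 ltW// weight_gt0. Qed.

Lemma sum_cell_weight : exists2 C : R, 0 <= C & (\sum_(k <oo) (cell_weight
    k)%:E <= C%:E)%E.
Proof.
pose s := 2 * alpha - 1.
have s0 : 0 < s by rewrite /s subr_gt0 mulrC -ltr_pdivrMr.
pose C := 1 + (a `^ (2 * alpha))^-1 * (1 + s^-1).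
have A0 : 0 <= (a `^ (2 * alpha))^-1 by rewrite invr_ge0 powR_ge0.
exists C; first by rewrite addr_ge0// mulr_ge0// addr_ge0// invr_ge0 ltW.
apply: lime_le; first by apply: is_cvg_nneseries => k _ _; rewrite lee_fin
    cell_weight_ge0.
apply: nearW => n; rewrite big_mkord sumEFin lee_fin.
case: n => [|n].
  by rewrite big_ord0 addr_ge0// mulr_ge0// addr_ge0// invr_ge0 ltW.
rewrite big_ord_recl; apply: lerD.
  by rewrite /cell_weight invf_le1 ?weight_gt0// lerDl powR_ge0.
apply: le_trans (ler_wpM2l A0 (sum_powR_le s n s0)); rewrite mulr_sumr.
apply: ler_sum => i _; rewrite -invfM /cell_weight lef_pV2 ?posrE
    ?weight_gt0//; last first.
  by rewrite mulr_gt0 ?powR_gt0.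
have -> : 1 + s = 2 * alpha by rewrite /s; ring.
rewrite /weight ger0_norm ?mulr_ge0 ?(ltW a0)// powRM// ?(ltW a0)//.
by rewrite mulrC lerDr.
Qed.

(** The two translates of a period on which [|t|] is at least [k * a], paired so that the line is
    cut into cells indexed by natural numbers. *)
Definition per_cell (k : nat) : set R :=
  `[(k%:R * a), (k.+1%:R * a)[%classic `|` `[(- (k.+1%:R * a)), (- (k%:R *
      a))[%classic.

Lemma per_cell_cover : \bigcup_k per_cell k = setT.
Proof.
apply/seteqP; split => // t _.
have /andP[] := floor_itv (t / a); rewrite ler_pdivlMr// ltr_pdivrMr// intrD.
case E : (Num.floor (t / a)) => [n|n] h1 h2; exists n => //; [left|right].
  by rewrite /= in_itv/= h1 -natr1.
rewrite /= in_itv/=; move: h1 h2; rewrite NegzE mulrNz.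
by rewrite -[n.+1%:~R]natr1 => h1 h2; apply/andP; split; lra.
Qed.

Lemma per_cell_trivIset : trivIset setT per_cell.
Proof.
pose c t := let m := Num.floor (t / a) in if m is Negz n then n else `|m|%N.
suff H k t : per_cell k t -> c t = k.
  by move=> i j _ _ [t [/H <- /H <-]].
rewrite /c; case=> /=; rewrite in_itv/= => /andP[h1 h2].
  suff -> : Num.floor (t / a) = k%:Z by [].
  apply/floor_def; rewrite ler_pdivlMr// ltr_pdivrMr// h1/=.
  by rewrite -PoszD addn1.
suff -> : Num.floor (t / a) = Negz k by [].
apply/floor_def; rewrite ler_pdivlMr// ltr_pdivrMr// NegzE.
rewrite mulrNz mulNr h1/= intrD mulrNz -[k.+1%:~R]natr1; lra.
Qed.

Notation mu := (@lebesgue_measure R).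

Lemma periodic_integral_cell (g : R -> R) (k : int) : bmeas g -> (forall t, 0
    <= g t) ->
  (forall t (k : int), g (t + k%:~R * a) = g t) ->
  (\int[mu]_(t in `[(k%:~R * a)%R, ((k + 1)%:~R * a)%R[) (g t)%:E =
   \int[mu]_(t in `]0%R, a[) (g t)%:E)%E.
Proof.
move=> [mg _] g0 gp.
have mgE : measurable_fun setT (fun t => (g t)%:E) by exact/measurable_EFinP.
rewrite -(integral_shift (k%:~R * a))//.
have -> : (fun t : R => t + k%:~R * a) @^-1` `[(k%:~R * a), ((k + 1)%:~R *
    a)[%classic = `[0, a[%classic.
  by apply/seteqP; split => t /=; rewrite !in_itv/= intrD => /andP[? ?];
      apply/andP; split; lra.
rewrite -integral_itv_obnd_cbnd; last by apply: measurable_funTS; under eq_fun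
    do rewrite gp.
by apply: eq_integral => t _; rewrite gp.
Qed.

(** On cell [k] the inverse weight is at most [cell_weight k], and [g] has the same integral on both
    translates as on one period. The sum of the [cell_weight k] converges because [2 * alpha > 1],
    which gives a constant independent of [g]. *)
Lemma periodic_weight_bound : exists2 C : R, 0 <= C &
  forall g : R -> R, bmeas g -> (forall t, 0 <= g t) ->
    (forall t (k : int), g (t + k%:~R * a) = g t) ->
    (\int[mu]_t (g t / weight t)%:E <= C%:E * \int[mu]_(t in `]0%R, a[) (g
        t)%:E)%E.
Proof.
have [C C0 hC] := sum_cell_weight.
exists (2 * C); first by rewrite mulr_ge0.
move=> g bg g0 gp; have [mg _] := bg.
have mgw : measurable_fun setT (fun t => (g t / weight t)%:E).
  by apply/measurable_EFinP; apply: measurable_funM => //; exact: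
      measurable_weightV.
have mgE : measurable_fun setT (fun t => (g t)%:E) by exact/measurable_EFinP.
have gw0 t : (0 <= (g t / weight t)%:E)%E by rewrite lee_fin divr_ge0// ltW//
    weight_gt0.
have mcell k : @measurable _ (measurableTypeR R) (per_cell k) by exact:
    measurableU.
set G := (\int[mu]_(t in `]0%R, a[) (g t)%:E)%E.
have G0 : (0 <= G)%E by apply: integral_ge0 => t _; rewrite lee_fin.
have cell k : (\int[mu]_(t in per_cell k) (g t / weight t)%:E <= (cell_weight
    k)%:E * (2%:E * G))%E.
  apply: (@le_trans _ _ (\int[mu]_(t in per_cell k) ((cell_weight k)%:E * (g
      t)%:E))%E).
    apply: ge0_le_integral => //.
    - exact: measurable_funTS.
    - by apply: measurable_funTS; apply: measurable_funeM.
    - move=> t kt; rewrite -EFinM lee_fin mulrC ler_wpM2r//.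
      rewrite /cell_weight lef_pV2 ?posrE ?weight_gt0// /weight lerD2l.
      apply: ge0_ler_powR; rewrite ?nnegrE//; first by rewrite mulr_ge0//
          (le_trans _ (ltW al)).
      have k0 : 0 <= k%:R * a by rewrite mulr_ge0// ltW.
      rewrite (ger0_norm k0); case: kt => /=; rewrite in_itv/= => /andP[h1 h2].
        exact: le_trans (ler_norm _).
      by rewrite -normrN; apply: le_trans (ler_norm _); lra.
  rewrite ge0_integralZl_EFin ?cell_weight_ge0//; last 2 first.
    by move=> t _; rewrite lee_fin.
    exact: measurable_funTS.
  apply: lee_wpmul2l; first by rewrite lee_fin cell_weight_ge0.
  rewrite ge0_integral_setU//; last 3 first.
    exact: measurable_funTS.
    by move=> t _; rewrite lee_fin.
    apply/disj_set2P; apply/seteqP; split => // t [/=]; rewrite !in_itv/= =>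
        /andP[h1 _] /andP[_ h2].
    have k0 : 0 <= k%:R * a by rewrite mulr_ge0// ltW.
    by have := le_lt_trans h1 h2; rewrite ltNge; case/negP; lra.
  have := periodic_integral_cell g k%:Z bg g0 gp.
  rewrite -PoszD addn1 => ->.
  have := periodic_integral_cell g (- k.+1%:Z) bg g0 gp.
  rewrite (_ : - k.+1%:Z + 1 = - k%:Z); last by lia.
  rewrite !mulrNz !mulNr => ->.
  by rewrite -/G mule_natl mule2n.
have -> : (\int[mu]_t (g t / weight t)%:E =
    \int[mu]_(t in \bigcup_k per_cell k) (g t / weight t)%:E)%E.
  by rewrite per_cell_cover.
rewrite ge0_integral_bigcup//; last 2 first.
  by rewrite per_cell_cover.
  exact: per_cell_trivIset.
apply: (@le_trans _ _ (\sum_(k <oo) (cell_weight k)%:E * (2%:E * G))%E).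
  apply: lee_nneseries => k _; last exact: cell.
  by move=> _; apply: integral_ge0.
have Gfin : G \is a fin_num.
  apply: integrable_fin_num; first exact: measurable_oa.
  exact: (bmeas_integrable _ _ (measurable_oa a) (measure_oa_fin a a0) bg).
rewrite -(fineK Gfin) in G0 *.
rewrite -[(2%:E * _)%E]EFinM; under eq_eseriesr do rewrite muleC.
rewrite nneseriesZl; last by move=> k _; rewrite lee_fin cell_weight_ge0.
rewrite -EFinM mulrAC [X in (_ <= X)%E]EFinM.
by apply: lee_wpmul2l => //; rewrite lee_fin mulr_ge0.
Qed.
End PSeries.

(** * Pairing with weighted square-integrable functions *)

Section WeightedPairing.
Context d (T : measurableType d) {R : realType} (m : {measure set T -> \bar R}).
Variables (W h : T -> R).
Hypothesis mW : measurable_fun setT W.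
Hypothesis mWV : measurable_fun setT (fun t => (W t)^-1).
Hypothesis W0 : forall t, 0 < W t.
Hypothesis mh : measurable_fun setT h.

Lemma amgm_weight (q x eta y : R) : 0 < eta -> 0 < y ->
  `|q * x| <= eta * (y * x ^+ 2) + eta^-1 * (q ^+ 2 / y).
Proof.
move=> e0 y0.
have -> : eta * (y * x ^+ 2) + eta^-1 * (q ^+ 2 / y) = (eta * y * `|x|) ^+ 2 /
    (eta * y) + `|q| ^+ 2 / (eta * y).
  rewrite !real_normK ?num_real// exprMn real_normK ?num_real//; field.
  by rewrite !gt_eqF.
rewrite -mulrDl ler_pdivlMr ?mulr_gt0// normrM.
set z := `|x|; set p := `|q|.
have : 0 <= (eta * y * z - p) ^+ 2 by exact: sqr_ge0.
have : 0 <= p * z * (eta * y) by rewrite !mulr_ge0 ?normr_ge0 ?ltW.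
by rewrite sqrrB mulr2n; lra.
Qed.


Let mWh : measurable_fun setT (fun t => (W t * h t ^+ 2)%:E).
Proof.
by apply/measurable_EFinP; apply: measurable_funM => //; exact: measurable_funX.
Qed.

Let Wh0 t : (0 <= (W t * h t ^+ 2)%:E)%E.
Proof. by rewrite lee_fin mulr_ge0 ?sqr_ge0// ltW. Qed.

(** An additive Cauchy-Schwarz inequality, from [amgm_weight]. As [q^2 = g] is required only where
    [h] does not vanish, [g] can be the restriction of [q^2] to a set carrying [h]. *)
Lemma weighted_pairing_bound (q g : T -> R) eta : 0 < eta ->
  measurable_fun setT q -> measurable_fun setT g -> (forall t, 0 <= g t) ->
  {ae m, forall t, h t = 0 \/ q t ^+ 2 = g t} ->
  (\int[m]_(t in setT) `|(q t * h t)%:E| <=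
    eta%:E * \int[m]_(t in setT) (W t * h t ^+ 2)%:E +
    eta^-1%:E * \int[m]_(t in setT) (g t / W t)%:E)%E.
Proof.
move=> e0 mq mg g0 hq.
have mgW : measurable_fun setT (fun t => (g t / W t)%:E).
  by apply/measurable_EFinP; exact: measurable_funM.
have gW0 t : (0 <= (g t / W t)%:E)%E by rewrite lee_fin divr_ge0// ltW.
apply: (@le_trans _ _ (\int[m]_(t in setT) (eta%:E * (W t * h t ^+ 2)%:E +
    eta^-1%:E * (g t / W t)%:E))%E).
  apply: ae_ge0_le_integral.
  - exact: measurableT.
  - by move=> t _.
  - by apply/measurable_EFinP; apply: measurableT_comp => //; exact:
        measurable_funM.
  - by move=> t _; rewrite adde_ge0// mule_ge0// lee_fin ?invr_ge0 ltW.
  - by apply: emeasurable_funD; exact: measurable_funeM.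
  - case: hq => A [mA A0 sA]; exists A; split => // t Ht; apply: sA => hqt;
        apply: Ht => _ /=.
    rewrite -!EFinM -EFinD lee_fin; case: hqt => [h0|<-]; last exact:
        amgm_weight.
    rewrite h0 mulr0 normr0 expr0n/= !mulr0 add0r.
    by rewrite !mulr_ge0 ?sqr_ge0 ?invr_ge0 ?(ltW e0) ?(ltW (W0 t)).
rewrite ge0_integralD; last 5 first.
- exact: measurableT.
- by move=> t _; rewrite mule_ge0// lee_fin ltW.
- exact: measurable_funeM.
- by move=> t _; rewrite mule_ge0// lee_fin invr_ge0 ltW.
- exact: measurable_funeM.
by rewrite !ge0_integralZl_EFin// ?invr_ge0 ltW.
Qed.

Lemma weighted_integrable : (\int[m]_(t in setT) (W t * h t ^+ 2)%:E < +oo)%E ->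
  (\int[m]_(t in setT) ((W t)^-1)%:E < +oo)%E ->
  m.-integrable setT (EFin \o h).
Proof.
move=> h1 h2; apply/integrableP; split; first exact/measurable_EFinP.
have := weighted_pairing_bound (fun=> 1) (fun=> 1) 1 ltr01 (measurable_cst _)
  (measurable_cst _) (fun=> ler01).
under eq_integral do rewrite mul1r.
rewrite invr1 !mul1e => /(_ _)/le_lt_trans; apply.
  by apply: aeW => t; right; rewrite expr1n.
by under [X in (_ + X < _)%E]eq_integral do rewrite div1r; exact:
    lte_add_pinfty.
Qed.

Lemma integrable_boundedM (b : T -> R) C : measurable_fun setT b ->
  (forall t, `|b t| <= C) -> m.-integrable setT (EFin \o h) ->
  m.-integrable setT (EFin \o (fun t => b t * h t)).
Proof.
move=> mb bC ih.
apply: (@le_integrable _ _ _ m setT _ _ (fun t => C%:E * (EFin \o h) t)%E) =>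
    //.
- by apply/measurable_EFinP; exact: measurable_funM.
- move=> t _ /=; rewrite lee_fin !normrM ler_wpM2r//.
  by apply: le_trans (bC t) _; exact: ler_norm.
- exact: integrableZl.
Qed.
End WeightedPairing.

(** * Pairing of trigonometric polynomials with a function carried by the spectrum *)

Section Pairing.
Context {R : realType}.
Variables (a alpha : R).
Hypothesis a0 : 0 < a.
Hypothesis al : 1 / 2 < alpha.
Notation mu := (@lebesgue_measure R).
Let w : R := 2 * pi / a.
Let D : set R := `]0, a[%classic.

Variable h : LebT R -> R.
Hypothesis mh : measurable_fun setT h.
Hypothesis hfin : (\int[@leb R]_(t in setT) (weight alpha t * h t ^+ 2)%:E <
    +oo)%E.

Let mW : measurable_fun (T := LebT R) setT (@weight R alpha).
Proof. exact: (borel_leb_measurable_fun _ _ _ (measurable_weight alpha)). Qed.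

Let mWV : measurable_fun (T := LebT R) setT (fun t => (weight alpha t)^-1).
Proof. exact: (borel_leb_measurable_fun _ _ _ (measurable_weightV alpha)). Qed.

Lemma bmeas_leb (b : R -> R) : bmeas b -> measurable_fun (T := LebT R) setT b.
Proof. by move=> [mb _]; exact: (borel_leb_measurable_fun _ _ _ mb). Qed.

Lemma integral_leb_weightV : (\int[@leb R]_(t in setT) ((weight alpha
    t)^-1)%:E < +oo)%E.
Proof.
have [C C0 hC] := periodic_weight_bound a alpha a0 al.
have := hC (fun=> 1) (bmeas_cst 1) (fun=> ler01) (fun _ _ => erefl).
under eq_integral do rewrite div1r.
rewrite -integral_leb; last 2 first.
- by apply/measurable_EFinP; exact: measurable_weightV.
- by move=> t; rewrite lee_fin invr_ge0 ltW// weight_gt0.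
move=> /le_lt_trans; apply.
by rewrite integral_cst/= ?(measure_oa a a0)// mul1e -EFinM ltry.
Qed.

Lemma leb_integrable_weighted : (@leb R).-integrable setT (EFin \o h).
Proof.
exact: (weighted_integrable _ _ (@leb R) _ _ mW mWV (weight_gt0 alpha) mh hfin
    integral_leb_weightV).
Qed.

Lemma leb_integrable_bmeasM (b : R -> R) : bmeas b ->
  (@leb R).-integrable setT (EFin \o (fun t => b t * h t)).
Proof.
move=> bb; have mb := bmeas_leb _ bb; have [_ [C bC]] := bb.
exact: (integrable_boundedM _ _ (@leb R) h mh b C mb bC
    leb_integrable_weighted).
Qed.

Variables (S : set R) (v : nat -> R -> R).
Hypothesis tv : forall i, tpoly w (v i).
Hypothesis Sv : forall t, S t -> ~ neg_all v t.
Hypothesis hS : {ae @leb R, forall t : LebT R, ~ S t -> h t = 0}.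

(** [C] depends on [h] but not on [Q] or [eta]. As [h] vanishes almost everywhere on [neg_all v],
    [Q^2] can be cut off there; the cut function is [a]-periodic, and [periodic_weight_bound] brings
    its weighted integral back to one period. *)
Lemma pairing_bound : exists2 C : R, 0 <= C & forall (Q : R -> R) eta,
  tpoly w Q -> 0 < eta ->
  `|\int[@leb R]_(t in setT) (Q t * h t)| <=
    eta * C + eta^-1 * (C * \int[mu]_(t in D `\` neg_all v) (Q t ^+ 2)).
Proof.
have [C C0 hC] := periodic_weight_bound a alpha a0 al.
pose V := (\int[@leb R]_(t in setT) (weight alpha t * h t ^+ 2)%:E)%E.
have Vy : (V < +oo)%E by exact: hfin.
have V0 : (0 <= V)%E.
  apply: integral_ge0 => t _; rewrite lee_fin mulr_ge0 ?sqr_ge0//.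
  by rewrite ltW// weight_gt0.
have Vfin : V \is a fin_num by rewrite ge0_fin_numE.
exists (Num.max (fine V) C); first by rewrite le_max C0 orbT.
move=> Q eta tQ e0.
have bQ := bmeas_tpoly _ _ tQ.
have mN := measurable_neg_all a v tv.
pose g t := Q t * Q t * \1_(~` neg_all v) t.
have bg : bmeas g.
  apply: bmeasM; first exact: bmeasM.
  by apply: bmeas_indic; exact: measurableC.
have g0 t : 0 <= g t by rewrite mulr_ge0// -expr2 sqr_ge0.
have gp t (k : int) : g (t + k%:~R * a) = g t.
  rewrite /g (tpoly_periodic a a0 Q t k tQ); congr (_ * _).
  rewrite !indicE; congr (_%:R); congr nat_of_bool.
  apply/idP/idP => /set_mem/= H; apply/mem_set => /= H2; apply: H => i.
    by rewrite (tpoly_periodic a a0 _ _ k (tv i)).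
  by rewrite -(tpoly_periodic a a0 _ _ k (tv i)).
have hq : {ae @leb R, forall t : LebT R, h t = 0 \/ Q t ^+ 2 = g t}.
  case: hS => A [mA A0 sA]; exists A; split; [exact: mA|exact: A0|].
  move=> t Ht; apply: sA => hSt; apply: Ht.
  have [nt|nt] := pselect (neg_all v t).
    by left; apply: hSt => /Sv; exact.
  by right; rewrite /g indicE mem_set// mulr1 expr2.
have E1 := weighted_pairing_bound _ _ (@leb R) _ _ mW mWV (weight_gt0 alpha) mh
  Q g eta e0 (bmeas_leb _ bQ) (bmeas_leb _ bg) g0 hq.
rewrite -/V in E1.
have E2 : (\int[@leb R]_(t in setT) (g t / weight alpha t)%:E <= C%:E *
    \int[mu]_(t in D) (g t)%:E)%E.
  apply: le_trans (hC g bg g0 gp); rewrite integral_leb; first exact: lexx.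
    by apply/measurable_EFinP; apply: measurable_funM; [case: bg|exact:
        measurable_weightV].
  by move=> t; rewrite lee_fin divr_ge0// ltW// weight_gt0.
have mDm : measurable D := measurable_oa a.
have fing : (\int[mu]_(t in D) (g t)%:E)%E \is a fin_num.
  apply: integrable_fin_num => //.
  exact: (bmeas_integrable _ _ mDm (measure_oa_fin a a0) bg).
have gE : \int[mu]_(t in D `\` neg_all v) (Q t ^+ 2) = fine (\int[mu]_(t in D)
    (g t)%:E)%E.
  rewrite setDE Rintegral_mkcondr; congr fine; apply: eq_integral => t _;
      congr EFin.
  by rewrite patchE /g indicE; case: ifP => _; rewrite ?mulr1 ?mulr0 ?expr2.
have iQh := leb_integrable_bmeasM _ bQ.
rewrite gE -lee_fin (EFin_normr_Rintegral measurableT iQh).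
apply: le_trans (le_abse_integral _ measurableT (measurable_int _ iQh)) _.
apply: (le_trans E1).
apply: (@le_trans _ _ (eta%:E * V + eta^-1%:E * (C%:E * \int[mu]_(t in D) (g
    t)%:E))%E).
  by rewrite leeD2l// lee_wpmul2l// lee_fin invr_ge0 ltW.
rewrite -(fineK fing) -(fineK Vfin) -!EFinM -EFinD lee_fin.
have G0 : 0 <= fine (\int[mu]_(t in D) (g t)%:E)%E.
  by apply: fine_ge0; apply: integral_ge0 => t _; rewrite lee_fin.
apply: lerD.
  by rewrite ler_wpM2l ?(ltW e0)// le_max lexx.
by rewrite ler_wpM2l ?invr_ge0 ?(ltW e0)// ler_wpM2r// le_max lexx orbT.
Qed.

Lemma pairing_eq0 (b : R -> R) (Q : nat -> R -> R) :
  (forall l, tpoly w (Q l)) ->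
  (forall l, \int[@leb R]_(t in setT) (Q l t * h t) =
             \int[@leb R]_(t in setT) (b t * h t)) ->
  (forall l, \int[mu]_(t in D `\` neg_all v) (Q l t ^+ 2) <= l.+1%:R^-1) ->
  \int[@leb R]_(t in setT) (b t * h t) = 0.
Proof.
move=> tQ QE Qle; have [C C0 hC] := pairing_bound.
set J := Rintegral _ _ _ in QE *.
apply/eqP; rewrite -normr_le0; apply/ler_addgt0Pr => e e0; rewrite add0r.
(* This gives [2 * C * eta <= e], the added 1 covering [C = 0]; with [1 / (l + 1) <= eta^2] both
   terms of the bound are at most [eta * C]. *)
pose eta := e / (2 * C + 1).
have C1 : 0 < 2 * C + 1 by rewrite ltr_wpDl// mulr_ge0.
have eta0 : 0 < eta by rewrite divr_gt0.
pose l := Num.truncn (eta^-1 ^+ 2).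
have hl : l.+1%:R^-1 <= eta ^+ 2.
  rewrite -[leRHS]invrK lef_pV2 ?posrE ?invr_gt0 ?exprn_gt0 ?ltr0n//.
  by rewrite -exprVn ltW// truncnS_gt.
have := hC (Q l) eta (tQ l) eta0; rewrite QE => /le_trans; apply.
apply: (@le_trans _ _ (eta * C + eta^-1 * (C * eta ^+ 2))).
  rewrite lerD2l ler_wpM2l ?invr_ge0 ?(ltW eta0)// ler_wpM2l//.
  exact: le_trans (Qle l) hl.
have -> : eta * C + eta^-1 * (C * eta ^+ 2) = eta * (2 * C).
  by field; rewrite gt_eqF.
by rewrite /eta mulrAC ler_pdivrMr// ler_wpM2l ?(ltW e0)// lerDl.
Qed.
End Pairing.

(** * Modulation and continuity of the inverse Fourier transform *)

Lemma Rintegral_dct_eq0 d (T : measurableType d) (R : realType)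
  (m : {measure set T -> \bar R}) (f_ : nat -> T -> R) (f g : T -> R) :
  (forall n, measurable_fun setT (f_ n)) -> measurable_fun setT f ->
  (forall t, f_ ^~ t @ \oo --> f t) ->
  m.-integrable setT (fun t => (g t)%:E) ->
  (forall n t, `|f_ n t| <= g t) ->
  (forall n, \int[m]_(t in setT) f_ n t = 0) ->
  \int[m]_(t in setT) f t = 0.
Proof.
move=> mf_ mf cf ig fg f0.
have [] := @dominated_convergence _ _ R m setT measurableT (fun n => EFin \o
    f_ n)
   (EFin \o f) (EFin \o g).
- by move=> n; exact/measurable_EFinP.
- exact/measurable_EFinP.
- by apply: aeW => t _; apply: cvg_EFin; [exact: nearW|exact: cf].
- exact: ig.
- by apply: aeW => t n _ /=; rewrite lee_fin.
move=> _ _; rewrite /Rintegral.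
have -> : (fun n => \int[m]_(t in setT) (EFin \o f_ n) t)%E = (fun=> 0%E).
  apply/funext => n.
  have ifn : m.-integrable setT (EFin \o f_ n).
    apply: (@le_integrable _ _ _ m setT _ _ (EFin \o g)) => //.
      exact/measurable_EFinP.
    by move=> t _ /=; rewrite lee_fin (ger0_norm (le_trans _ (fg n t))).
  rewrite -[LHS](fineK (integrable_fin_num measurableT ifn)).
  by congr EFin; exact: f0.
by move=> /(cvg_lim (@ereal_hausdorff R)) <-; rewrite lim_cst.
Qed.

Section Modulation.
Context {R : realType}.
Variables (a alpha : R).
Hypothesis a0 : 0 < a.
Hypothesis al : 1 / 2 < alpha.
Let w : R := 2 * pi / a.
Variable F : R -> R[i].
Let u : LebT R -> R := fun t => complex.Re (F t).
Let z : LebT R -> R := fun t => complex.Im (F t).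
Hypothesis mRe : measurable_fun setT u.
Hypothesis mIm : measurable_fun setT z.
Hypothesis Ffin : (\int[@leb R]_(t in setT)
  ((1 + `|t| `^ (2 * alpha)) * (u t ^+ 2 + z t ^+ 2))%:E < +oo)%E.

(** Together with [modIm], the real and imaginary parts of [F (t) e^(2 pi i t x)]. *)
Definition modRe (x : R) (t : LebT R) : R :=
  cos (2 * pi * t * x) * complex.Re (F t) - sin (2 * pi * t * x) * complex.Im
      (F t).
Definition modIm (x : R) (t : LebT R) : R :=
  sin (2 * pi * t * x) * complex.Re (F t) + cos (2 * pi * t * x) * complex.Im
      (F t).

Lemma inv_fourierE x : inv_fourier F x =
  Complex (\int[@leb R]_(t in setT) modRe x t) (\int[@leb R]_(t in setT) modIm
      x t).
Proof. by []. Qed.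

Lemma bmeas_cos_phase (x : R) : bmeas (fun t : R => cos (2 * pi * t * x)).
Proof.
have := bmeas_tpoly _ _ (tpoly_cos (2 * pi * x) 1).
by under eq_fun do rewrite mul1r mulrAC.
Qed.

Lemma bmeas_sin_phase (x : R) : bmeas (fun t : R => sin (2 * pi * t * x)).
Proof.
have := bmeas_tpoly _ _ (tpoly_sin (2 * pi * x) 1).
by under eq_fun do rewrite mul1r mulrAC.
Qed.

Lemma measurable_modRe x : measurable_fun setT (modRe x).
Proof.
apply: measurable_funB; apply: measurable_funM.
- exact: bmeas_leb (bmeas_cos_phase x).
- exact: mRe.
- exact: bmeas_leb (bmeas_sin_phase x).
- exact: mIm.
Qed.

Lemma measurable_modIm x : measurable_fun setT (modIm x).
Proof.
apply: measurable_funD; apply: measurable_funM.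
- exact: bmeas_leb (bmeas_sin_phase x).
- exact: mRe.
- exact: bmeas_leb (bmeas_cos_phase x).
- exact: mIm.
Qed.

Lemma modRe_modIm_sqr x t : modRe x t ^+ 2 + modIm x t ^+ 2 = u t ^+ 2 + z t
    ^+ 2.
Proof.
rewrite /modRe /modIm /u /z; have := cos2Dsin2 (2 * pi * t * x).
set c := cos _; set s := sin _; set p := complex.Re _; set q := complex.Im _
    => e.
have -> : (c * p - s * q) ^+ 2 + (s * p + c * q) ^+ 2 =
  (c ^+ 2 + s ^+ 2) * (p ^+ 2 + q ^+ 2) by ring.
by rewrite e mul1r.
Qed.

Lemma weighted_le_fin (h : LebT R -> R) : measurable_fun setT h ->
  (forall t, h t ^+ 2 <= u t ^+ 2 + z t ^+ 2) ->
  (\int[@leb R]_(t in setT) (weight alpha t * h t ^+ 2)%:E < +oo)%E.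
Proof.
move=> mh hle; apply: le_lt_trans Ffin.
have mW : measurable_fun (T := LebT R) setT (@weight R alpha).
  exact: (borel_leb_measurable_fun _ _ _ (measurable_weight alpha)).
apply: ge0_le_integral.
- exact: measurableT.
- move=> t _; rewrite lee_fin mulr_ge0 ?sqr_ge0//.
  by rewrite ltW// weight_gt0.
- apply/measurable_EFinP; apply: measurable_funM; first exact: mW.
  exact: measurable_funX.
- apply/measurable_EFinP; apply: (@measurable_funM _ (LebT R) R setT (@weight
      R alpha) (fun t => u t ^+ 2 + z t ^+ 2)); first exact: mW.
  by apply: measurable_funD; exact: measurable_funX.
- move=> t _; rewrite lee_fin; apply: ler_wpM2l; last exact: hle.
  by rewrite ltW// weight_gt0.
Qed.

Lemma modRe_fin x :
  (\int[@leb R]_(t in setT) (weight alpha t * modRe x t ^+ 2)%:E < +oo)%E.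
Proof.
apply: weighted_le_fin; first exact: measurable_modRe.
by move=> t; rewrite -(modRe_modIm_sqr x) lerDl sqr_ge0.
Qed.

Lemma modIm_fin x :
  (\int[@leb R]_(t in setT) (weight alpha t * modIm x t ^+ 2)%:E < +oo)%E.
Proof.
apply: weighted_le_fin; first exact: measurable_modIm.
by move=> t; rewrite -(modRe_modIm_sqr x) lerDr sqr_ge0.
Qed.

Lemma integrable_bmeas_modRe x b : bmeas b ->
  (@leb R).-integrable setT (EFin \o (fun t => b t * modRe x t)).
Proof. exact: (leb_integrable_bmeasM a alpha a0 al _ (measurable_modRe x)
    (modRe_fin x)). Qed.

Lemma integrable_bmeas_modIm x b : bmeas b ->
  (@leb R).-integrable setT (EFin \o (fun t => b t * modIm x t)).
Proof. exact: (leb_integrable_bmeasM a alpha a0 al _ (measurable_modIm x)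
    (modIm_fin x)). Qed.

Definition ccoef (h : LebT R -> R) (n : nat) : R :=
  \int[@leb R]_(t in setT) (cos (n%:R * (w * t)) * h t).
Definition scoef (h : LebT R -> R) (n : nat) : R :=
  \int[@leb R]_(t in setT) (sin (n%:R * (w * t)) * h t).

Let bc n : bmeas (fun t => cos (n%:R * (w * t))).
Proof. exact/bmeas_tpoly/tpoly_cos. Qed.

Let bs n : bmeas (fun t => sin (n%:R * (w * t))).
Proof. exact/bmeas_tpoly/tpoly_sin. Qed.

(** Moving by [n / a] multiplies the integrand by [cos (n w t) + i sin (n w t)]; the sign [e] treats
    [n] and [- n] at once, the frequencies of [tb] being natural numbers. *)
Lemma inv_fourier_shift (e : R) n x : e = 1 \/ e = -1 ->
  inv_fourier F (e * n%:R / a + x) =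
  Complex (ccoef (modRe x) n - e * scoef (modIm x) n)
          (e * scoef (modRe x) n + ccoef (modIm x) n).
Proof.
move=> he; rewrite inv_fourierE.
have phase t : 2 * pi * t * (e * n%:R / a + x) = e * (n%:R * (w * t)) + 2 * pi
    * t * x.
  by rewrite /w; ring.
have ce y : cos (e * y) = cos y by case: he => ->; rewrite ?mul1r ?mulN1r ?cosN.
have se y : sin (e * y) = e * sin y by case: he => ->; rewrite ?mul1r ?mulN1r
    ?sinN.
have icR := integrable_bmeas_modRe x _ (bc n).
have isR := integrable_bmeas_modRe x _ (bmeasZ e _ (bs n)).
have icI := integrable_bmeas_modIm x _ (bc n).
have isI := integrable_bmeas_modIm x _ (bmeasZ e _ (bs n)).
have isR' := integrable_bmeas_modRe x _ (bs n).
have isI' := integrable_bmeas_modIm x _ (bs n).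
congr Complex.
- transitivity (\int[@leb R]_(t in setT)
    (cos (n%:R * (w * t)) * modRe x t - e * sin (n%:R * (w * t)) * modIm x t)).
    apply: eq_Rintegral => t _; rewrite /modRe /modIm phase cosD sinD ce se.
    by ring.
  rewrite (RintegralB measurableT icR isI); congr (_ - _).
  rewrite -(RintegralZl _ measurableT isI').
  by apply: eq_Rintegral => t _; rewrite -[LHS]mulrA.
- transitivity (\int[@leb R]_(t in setT)
    (e * sin (n%:R * (w * t)) * modRe x t + cos (n%:R * (w * t)) * modIm x t)).
    apply: eq_Rintegral => t _; rewrite /modRe /modIm phase cosD sinD ce se.
    by ring.
  rewrite (RintegralD measurableT isR icI); congr (_ + _).
  rewrite -(RintegralZl _ measurableT isR').
  by apply: eq_Rintegral => t _; rewrite -[LHS]mulrA.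
Qed.

(** The two complex values are four real combinations of the four coefficients; sums and differences
    recover each coefficient. *)
Lemma inv_fourier_pm_eq0 n x :
  (inv_fourier F (n%:R / a + x) = 0 /\ inv_fourier F (- n%:R / a + x) = 0) <->
  [/\ ccoef (modRe x) n = 0, scoef (modRe x) n = 0,
      ccoef (modIm x) n = 0 & scoef (modIm x) n = 0].
Proof.
have := inv_fourier_shift 1 n x (or_introl erefl).
have := inv_fourier_shift (-1) n x (or_intror erefl).
rewrite mul1r mulN1r => -> ->; split.
  by move=> [[h1 h2] [h3 h4]]; split; lra.
by move=> [-> -> -> ->]; rewrite !mulr0 subr0 addr0.
Qed.

Let ui : (@leb R).-integrable setT (EFin \o u).
Proof.
apply: (leb_integrable_weighted a alpha a0 al _ mRe); apply: weighted_le_fin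
    => //.
by move=> t; rewrite lerDl sqr_ge0.
Qed.

Let zi : (@leb R).-integrable setT (EFin \o z).
Proof.
apply: (leb_integrable_weighted a alpha a0 al _ mIm); apply: weighted_le_fin
    => //.
by move=> t; rewrite lerDr sqr_ge0.
Qed.

(** The points [q / a] are dense, and [inv_fourier F] passes to the limit by dominated convergence
    with majorant [|Re F| + |Im F|], integrable thanks to the weight. *)
Lemma inv_fourier_dense_eq0 :
  (forall q : rat, inv_fourier F (ratr q / a) = 0) -> forall x, inv_fourier F
      x = 0.
Proof.
move=> Fq x.
have Hq n : exists q : rat, `|x - ratr q / a| < n.+1%:R^-1.
  have e0 : 0 < n.+1%:R^-1 :> R by rewrite invr_gt0.
  have lt : a * (x - n.+1%:R^-1) < a * (x + n.+1%:R^-1).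
    by rewrite ltr_pM2l// ltrD2l; apply: lt_trans e0; rewrite oppr_lt0.
  have [q] := rat_in_itvoo lt.
  rewrite in_itv/= => /andP[h1 h2]; exists q.
  by rewrite distrC ltr_distl ltr_pdivlMr// ltr_pdivrMr// ![_ * a]mulrC h1 h2.
have [q qP] := choice Hq.
have cq : (fun n => ratr (q n) / a : R) @ \oo --> x.
  apply/cvgrPdist_lt => e e0.
  have [n ne] : exists n : nat, n.+1%:R^-1 < e.
    exists (Num.truncn e^-1); rewrite -[ltRHS]invrK ltf_pV2 ?posrE ?invr_gt0
        ?ltr0n//.
    exact: truncnS_gt.
  exists n => // k /= nk; apply: lt_trans (qP k) _; apply: le_lt_trans ne.
  by rewrite lef_pV2 ?posrE ?ltr0n// ler_nat.
have ccos (t : R) : cos (2 * pi * t * (ratr (q n) / a)) @[n --> \oo] --> cos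
    (2 * pi * t * x).
  apply: continuous_cvg; first exact: continuous_cos.
  by apply: cvgM => //; exact: cvg_cst.
have csin (t : R) : sin (2 * pi * t * (ratr (q n) / a)) @[n --> \oo] --> sin
    (2 * pi * t * x).
  apply: continuous_cvg; first exact: continuous_sin.
  by apply: cvgM => //; exact: cvg_cst.
have Fqn n : \int[@leb R]_(t in setT) modRe (ratr (q n) / a) t = 0 /\
             \int[@leb R]_(t in setT) modIm (ratr (q n) / a) t = 0.
  by have := Fq (q n); rewrite inv_fourierE => -[-> ->].
rewrite inv_fourierE.
have ig : (@leb R).-integrable setT (fun t => (`|u t| + `|z t|)%:E).
  have := integrableD measurableT (integrable_abse ui) (integrable_abse zi).
  exact.
have bnd (c s p r : R) : `|c| <= 1 -> `|s| <= 1 -> `|c * p| + `|s * r| <= `|p|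
    + `|r|.
  by move=> c1 s1; rewrite !normrM; apply: lerD; rewrite ler_piMl.
have -> : \int[@leb R]_(t in setT) modRe x t = 0.
  apply: (Rintegral_dct_eq0 _ _ _ (@leb R) (fun n => modRe (ratr (q n) / a)) _
      _ _ _ _ ig).
  - by move=> n; exact: measurable_modRe.
  - exact: measurable_modRe.
  - move=> t; apply: cvgB; (apply: cvgM; last exact: cvg_cst); [exact:
        ccos|exact: csin].
  - move=> n t; apply: le_trans (ler_normB _ _) _.
    by apply: bnd; [exact: cos_max|exact: sin_max].
  - by move=> n; have [] := Fqn n.
have -> : \int[@leb R]_(t in setT) modIm x t = 0.
  apply: (Rintegral_dct_eq0 _ _ _ (@leb R) (fun n => modIm (ratr (q n) / a)) _
      _ _ _ _ ig).
  - by move=> n; exact: measurable_modIm.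
  - exact: measurable_modIm.
  - move=> t; apply: cvgD; (apply: cvgM; last exact: cvg_cst); [exact:
        csin|exact: ccos].
  - move=> n t; apply: le_trans (ler_normD _ _) _.
    by apply: bnd; [exact: sin_max|exact: cos_max].
  - by move=> n; have [] := Fqn n.
by [].
Qed.
End Modulation.

(** * The uniqueness set *)

(** The block end [M'] is chosen before [i0], so that one block serves both the cosine and the sine
    of frequency [m]. *)
Lemma tb_approx_block {R : realType} (a : R) (v : nat -> R -> R) : 0 < a ->
  (forall i, tpoly (2 * pi / a) (v i)) -> (forall i t, `|v i t| <= 1) ->
  (forall i, countable [set t | `]0, a[%classic t /\ v i t = 0]) ->
  (0 < @lebesgue_measure R (`]0%R, a[%classic `&` neg_all v))%E ->
  forall M m l : nat, exists M', (M < M')%N /\ forall i0, uphalf i0 = m ->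
  exists N N' (c : nat -> R),
    (forall i, (N <= i < N')%N -> (M < uphalf i < M')%N) /\
    \int[@lebesgue_measure R]_(t in `]0, a[%classic `\` neg_all v)
      (tb (2 * pi / a) i0 t + \sum_(N <= i < N') c i * tb (2 * pi / a) i t) ^+ 2
      <= l.+1%:R^-1.
Proof.
move=> a0 tv v1 v0 B0 M m l.
(* Indices from [N] on have frequency above [M], while every index of frequency [m] is below [N]. *)
pose N := ((maxn M m).*2.+1)%N.
have l0 : 0 < l.+1%:R^-1 :> R by rewrite invr_gt0 ltr0n.
have H i0 : exists p : nat * (nat -> R), (i0 < N)%N ->
    \int[@lebesgue_measure R]_(t in `]0, a[%classic `\` neg_all v)
      (tb (2 * pi / a) i0 t + \sum_(N <= i < p.1) p.2 i * tb (2 * pi / a) i t)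
          ^+ 2
      <= l.+1%:R^-1.
  have [iN|] := ltnP i0 N; last by exists (0%N, fun=> 0).
  have [N' [c hc]] := tb_approx a a0 v tv v1 v0 B0 N i0 _ iN l0.
  by exists (N', c).
have [p pP] := choice H.
exists ((\max_(i < N) (p i).1) + M).+1%N; split; first by rewrite ltnS leq_addl.
move=> i0 um.
have up i : uphalf i = (odd i + i./2)%N by rewrite uphalf_half.
have i0N : (i0 < N)%N.
  have := odd_double_half i0; have := up i0; rewrite um /N => e1 e2.
  by have := leq_maxr M m; lia.
exists N, (p i0).1, (p i0).2; split; last exact: pP.
move=> i /andP[Ni iN']; have e1 := up i; have e2 := odd_double_half i.
have := leq_maxl M m; rewrite /N in Ni => MM.
have := @leq_bigmax _ (fun i : 'I_N => (p i).1) (Ordinal i0N) => /= pM.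
by apply/andP; split; lia.
Qed.

Lemma leb_pairing_sum_eq0 {R : realType} (w : R) (h : LebT R -> R) (c : nat ->
    R)
    (r : seq nat) :
  (forall b, bmeas b -> (@leb R).-integrable setT (EFin \o (fun t => b t * h
      t))) ->
  (forall i, i \in r -> \int[@leb R]_(t in setT) (tb w i t * h t) = 0) ->
  \int[@leb R]_(t in setT) ((\sum_(i <- r) c i * tb w i t) * h t) = 0.
Proof.
move=> ih; elim: r => [|i r IH] h0.
  under eq_Rintegral do rewrite big_nil mul0r.
  by rewrite Rintegral_cst ?mul0r.
under eq_Rintegral do rewrite big_cons mulrDl -mulrA.
have i1 := ih _ (bmeas_tb w i).
have i2 := ih _ (bmeas_sum _ r (fun j t => c j * tb w j t)
  (fun j => bmeasZ (c j) _ (bmeas_tb w j))).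
have i3 : (@leb R).-integrable setT (EFin \o (fun t => c i * (tb w i t * h t))).
  have := ih _ (bmeasZ (c i) _ (bmeas_tb w i)).
  by congr (_.-integrable _ _); apply/funext => t /=; rewrite mulrA.
rewrite (RintegralD measurableT i3 i2) (RintegralZl _ measurableT i1).
rewrite h0 ?mem_head// mulr0 add0r; apply: IH => j jr.
by apply: h0; rewrite in_cons jr orbT.
Qed.

Lemma tb_coef {R : realType} (a : R) (h : LebT R -> R) i :
  \int[@leb R]_(t in setT) (tb (2 * pi / a) i t * h t) =
  if odd i then scoef a h (uphalf i) else ccoef a h (uphalf i).
Proof. by rewrite /tb; case: (odd i). Qed.

Lemma coef_eq0 {R : realType} (a : R) (h : LebT R -> R) m :
  (forall i, uphalf i = m ->
    \int[@leb R]_(t in setT) (tb (2 * pi / a) i t * h t) = 0) ->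
  ccoef a h m = 0 /\ scoef a h m = 0.
Proof.
move=> hv; split.
  have := hv m.*2 (uphalf_double m).
  by rewrite tb_coef odd_double uphalf_double.
case: m hv => [|k] hv.
  (* No index of [tb] carries a sine of frequency zero; that coefficient is zero by itself. *)
  rewrite /scoef; under eq_Rintegral do rewrite mul0r sin0 mul0r.
  by rewrite Rintegral_cst ?mul0r.
have uk : uphalf k.*2.+1 = k.+1 by rewrite /= doubleK.
have := hv k.*2.+1 uk.
by rewrite tb_coef uk /= odd_double.
Qed.

Theorem theorem3 (R : realType) (S : set R) (a : R) :
  leb_measurable S -> 0 < a -> (leb (S_per S a : set (LebT R)) < a%:E)%E ->
  exists L : set R,
    uniformly_discrete L /\ has_uniform_density L a /\
    forall alpha : R, 1 / 2 < alpha -> uniqueness_set L (in_W alpha S).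
Proof.
move=> _ a0 Sa.
have [v [tv v1 v0 B0 Sv]] := per_cover a a0 S Sa.
(* Every pair of a rational and a precision is scheduled at its [pickle] code; a number that codes
   no pair gets the default [(0, 0)]. *)
pose tg (k : nat) : rat * nat := odflt (0, 0%N) (unpickle k).
pose y k : R := ratr (tg k).1.
(* The target [y k / a] splits into [floor (y k) / a], accounted for by a frequency, and the
   translation [X k], which lies in [[0, 1 / a]]. *)
pose X k : R := (y k - (Num.floor (y k))%:~R) / a.
have Hs (p : nat * nat) := tb_approx_block a v a0 tv v1 v0 B0 p.2
  `|Num.floor (y p.1)|%N (tg p.1).2.
have [step stepP] := choice Hs.
(* [step] receives the number of a block with its start and returns its end; the frequency and
   precision to reach come from [tg]. *)
pose M := fix M k := if k is k'.+1 then step (k', M k') else 0%N.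
have MS k : M k.+1 = step (k, M k) by [].
have Mlt k : (M k < M k.+1)%N by rewrite MS; exact: (stepP (k, M k)).1.
have aX k : 0 <= a * X k <= 1.
  rewrite /X mulrCA mulfV ?gt_eqF// mulr1.
  have /andP[f1 f2] := floor_itv (y k); rewrite intrD in f2.
  by apply/andP; split; lra.
have [L [Ld LD LX]] := block_lattice a M X a0 erefl Mlt aX.
exists L; split => //; split => // alpha al f [F [mRe [mIm [Ffin [FS fE]]]]] fL.
move=> x; rewrite fE; move: x.
apply: (inv_fourier_dense_eq0 a alpha a0 al F mRe mIm Ffin) => q.
(* Since [q / a = n0 / a + x], the value there is determined by the coefficients of frequency
   [m = |n0|] of [F] modulated by [x]. *)
pose yq : R := ratr q; pose n0 : int := Num.floor yq.
pose x := (yq - n0%:~R) / a; pose m := `|n0|%N.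
have iRe := integrable_bmeas_modRe a alpha a0 al F mRe mIm Ffin x.
have iIm := integrable_bmeas_modIm a alpha a0 al F mRe mIm Ffin x.
have pm := inv_fourier_pm_eq0 a alpha a0 al F mRe mIm Ffin.
have tgE (l : nat) : tg (pickle (q, l)) = (q, l) by rewrite /tg pickleK.
have XE (l : nat) : X (pickle (q, l)) = x by rewrite /X /y tgE.
have FL (l : nat) (n : int) : (M (pickle (q, l)) < `|n|%N < M (pickle (q,
    l)).+1)%N ->
    inv_fourier F (n%:~R / a + x) = 0.
  by move=> hn; rewrite -fE -(XE l); apply: fL; exact: LX.
have block (l i : nat) : (M (pickle (q, l)) < uphalf i < M (pickle (q,
    l)).+1)%N ->
    \int[@leb R]_(t in setT) (tb (2 * pi / a) i t * modRe F x t) = 0 /\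
    \int[@leb R]_(t in setT) (tb (2 * pi / a) i t * modIm F x t) = 0.
  move=> hi; have [|c1 s1 c2 s2] := (pm (uphalf i) x).1.
    split; first exact: (FL l (uphalf i)%:Z).
    have := FL l (- (uphalf i)%:Z); rewrite abszN mulrNz; exact.
  by rewrite !tb_coef c1 s1 c2 s2; case: (odd i).
(* For each precision [l], block [pickle (q, l)] supplies [Q] equal to [tb i0] plus frequencies
   orthogonal to [h]. Its pairing with [h] is that of [tb i0], while its [L^2] norm on one period of
   [U] tends to zero with [l]. *)
have vanish (h : LebT R -> R) i0 : measurable_fun setT h ->
    (\int[@leb R]_(t in setT) (weight alpha t * h t ^+ 2)%:E < +oo)%E ->
    (forall b, bmeas b -> (@leb R).-integrable setT (EFin \o (fun t => b t * h
        t))) ->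
    {ae @leb R, forall t : LebT R, ~ S t -> h t = 0} ->
    (forall l i : nat, (M (pickle (q, l)) < uphalf i < M (pickle (q, l)).+1)%N
        ->
      \int[@leb R]_(t in setT) (tb (2 * pi / a) i t * h t) = 0) ->
    uphalf i0 = m ->
    \int[@leb R]_(t in setT) (tb (2 * pi / a) i0 t * h t) = 0.
  move=> mh hfin ih hS hb um.
  have Hl (l : nat) : exists Q : R -> R, [/\ tpoly (2 * pi / a) Q,
      \int[@leb R]_(t in setT) (Q t * h t) =
        \int[@leb R]_(t in setT) (tb (2 * pi / a) i0 t * h t) &
      \int[@lebesgue_measure R]_(t in `]0, a[%classic `\` neg_all v) (Q t ^+
          2) <= l.+1%:R^-1].
    have := (stepP (pickle (q, l), M (pickle (q, l)))).2 i0.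
    rewrite -MS /y tgE => /(_ um)[N [N' [c [cb ci]]]].
    exists (fun t => tb (2 * pi / a) i0 t + \sum_(N <= i < N') c i * tb (2 *
        pi / a) i t).
    split => //.
      apply: tpolyD; first exact: tpoly_tb.
      by apply: tpoly_sum => i; apply: tpolyZ; exact: tpoly_tb.
    under eq_Rintegral do rewrite mulrDl.
    have i2 := ih _ (bmeas_sum _ (index_iota N N') (fun j t => c j * tb (2 *
        pi / a) j t)
      (fun j => bmeasZ (c j) _ (bmeas_tb (2 * pi / a) j))).
    rewrite (RintegralD measurableT (ih _ (bmeas_tb _ i0)) i2).
    rewrite leb_pairing_sum_eq0 ?addr0// => i; rewrite mem_index_iota => iN.
    by apply: (hb l); exact: cb.
  have [Q QP] := choice Hl.
  apply: (pairing_eq0 a alpha a0 al h mh hfin S v tv Sv hS _ Q) => l; by have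
      [] := QP l.
have vRe i0 : uphalf i0 = m -> \int[@leb R]_(t in setT) (tb (2 * pi / a) i0 t
    * modRe F x t) = 0.
  apply: vanish.
  - exact: measurable_modRe.
  - exact: modRe_fin.
  - exact: iRe.
  - case: FS => A [mA A0 sA]; exists A; split; [exact: mA|exact: A0|].
    move=> t Ht; apply: sA => FSt; apply: Ht => /FSt F0.
    by rewrite /modRe F0 /= !mulr0 subr0.
  - by move=> l i /block[].
have vIm i0 : uphalf i0 = m -> \int[@leb R]_(t in setT) (tb (2 * pi / a) i0 t
    * modIm F x t) = 0.
  apply: vanish.
  - exact: measurable_modIm.
  - exact: modIm_fin.
  - exact: iIm.
  - case: FS => A [mA A0 sA]; exists A; split; [exact: mA|exact: A0|].
    move=> t Ht; apply: sA => FSt; apply: Ht => /FSt F0.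
    by rewrite /modIm F0 /= !mulr0 addr0.
  - by move=> l i /block[].
have [c1 s1] := coef_eq0 _ _ _ vRe; have [c2 s2] := coef_eq0 _ _ _ vIm.
have [p1 p2] := (pm m x).2 (And4 c1 s1 c2 s2).
have -> : ratr q / a = n0%:~R / a + x by rewrite /x -mulrDl addrC subrK.
have [n00|n00] := leP 0 n0.
  by have -> : n0%:~R = m%:R :> R by rewrite /m -[in LHS](gez0_abs n00).
have n0E : n0 = - m%:Z by rewrite /m; lia.
by rewrite n0E mulrNz; exact: p2.
Qed.
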